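(* For the Asian call option with payoff function $f(x)=(x-K)^+$, the conditional Malliavin (CMV) estimates $\mathbb E_{\mathbb Q}[\hat\theta_d\mid\boldsymbol Z]$ of delta, gamma and vega are given respectively by $$G_{\Delta,2}(K;\boldsymbol Z)=-\frac{2e^{-rT}}{T\sigma^2}\Phi_1+\Big(\frac{2e^{-rT}\tilde S_d}{TS_0\sigma^2}e^{rt_1}-\frac{2e^{-rT}\omega\tilde S_A}{S_0\sigma^2}e^{rt_1}\Big)\tilde\Phi_2-KG_{\Delta,1}(K;\boldsymbol Z);$$ $$\begin{aligned}G_{\Gamma,2}(K;\boldsymbol Z)=&\Big(\frac{8\omega e^{-rT}}{\sigma^4S_0T}-\frac{8e^{-rT}\tilde S_d}{\sigma^4S_0T^2\tilde S_A}\Big)\Phi_1+\frac{4e^{-rT}}{\sigma^4T^2\tilde S_A}e^{-rt_1+\sigma^2t_1}\Phi_2\\&+\Big(\frac{4e^{-rT}\tilde S_d^2}{\sigma^4S_0^2T^2\tilde S_A}e^{rt_1}+\frac{4e^{-rT}\omega r\tilde S_A}{\sigma^4S_0^2}e^{rt_1}-\frac{8r\tilde S_de^{-rT}}{\sigma^4S_0^2T}e^{rt_1}\Big)\tilde\Phi_2-KG_{\Gamma,1}(K;\boldsymbol Z);\end{aligned}$$ $$\begin{aligned}G_{\vartheta,2}(K;\boldsymbol Z)=&-\frac{2e^{-rT}S_0}{\sigma^2T\tilde S_Ad}\,\mathsf B\,\Phi_1-KG_{\vartheta,1}(K;\boldsymbol Z)-\frac{2e^{-rT}S_0\sqrt{t_1}}{\sigma^2T}\frac{1}{\sqrt{2\pi}}e^{-\psi_d^2/2}\\&+\Bigg[\frac{2e^{-rT}\tilde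 S_d}{\sigma^2T\tilde S_Ad}\,\mathsf B\,e^{rt_1}+\Big(\frac{2e^{-rT}\tilde S_d\sqrt{t_1}}{\sigma^2T}-\frac{2e^{-rT}\tilde S_A}{\sigma^2}\sqrt{t_1}(r-\sigma^2)-\frac{2e^{-rT}\sqrt{t_1}}{\tilde S_Ad^2}\mathsf D\Big)\sigma\sqrt{t_1}\,e^{\sigma^2t_1/2+\omega t_1}\\&\qquad-\frac{2e^{-rT}(r-\sigma^2)}{\sigma^2d}\,\mathsf B\,e^{rt_1}-\frac{2e^{-rT}}{d^2\tilde S_A}\,\mathsf C\,e^{rt_1}-\frac{\tilde S_Ae^{-rT}}{\sigma}e^{rt_1}\Bigg]\tilde\Phi_2\\&+\Big(\frac{2e^{-rT}\tilde S_d\sqrt{t_1}}{\sigma^2T}-\frac{2e^{-rT}\tilde S_A}{\sigma^2}\sqrt{t_1}(r-\sigma^2)-\frac{2e^{-rT}\sqrt{t_1}}{\tilde S_Ad^2}\mathsf D\Big)\frac{1}{\sqrt{2\pi}}e^{\sigma^2t_1/2+\omega t_1-(\psi_d-\sigma\sqrt{t_1})^2/2},\end{aligned}$$ where $\Phi_1:=\Phi(-\psi_d)$, $\Phi_2:=\Phi(-\sigma\sqrt{t_1}-\psi_d)$, $\tilde\Phi_2:=\Phi(\sigma\sqrt{t_1}-\psi_d)$, $\mathsf B:=\sum_{j=1}^d\tilde S_j(\boldsymbol A_{j-1}\boldsymbol Z-\sigma t_j)$, $\mathsf C:=\sum_{i=1}^d\sum_{j=i}^d\tilde S_i\tilde S_j(\boldsymbol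 A_{j-1}\boldsymbol Z-\sigma t_j)$, $\mathsf D:=\sum_{i=1}^d\sum_{j=i}^d\tilde S_i\tilde S_j$, and $G_{\Delta,1},G_{\Gamma,1},G_{\vartheta,1}$ are the CMV estimates for the binary Asian option Greeks (explicit formulas in the context).
   Context: One-asset Black–Scholes model under the risk-neutral measure $\mathbb Q$: $S_t=S_0\exp(\omega t+\sigma\tilde W_t)$, $0\le t\le T$, with $S_0>0$, $r>0$, $\sigma>0$, $\omega=r-\frac12\sigma^2$, $\tilde W$ a standard Brownian motion under $\mathbb Q$. Let $K>0$ be the strike, $d\ge2$, $t_j=jT/d$, $S_j=S_{t_j}$, $S_A=\frac1d\sum_{j=1}^dS_j$. For a payoff function $f$, the simulation estimates $\hat\theta_d$ of the Greeks are $\hat\theta_d=e^{-rT}f(S_A)\,\mathrm{weight}(S_A,S_d,y,z)$ with $y=\frac Td\sum_{j=1}^dS_j(\tilde W_{t_j}-\sigma t_j)$, $z=\frac{T^2}{d^2}\sum_{i=1}^d\sum_{j=i}^dS_iS_j(\tilde W_{t_j}-\sigma t_j)$ and - delta: $\mathrm{weight}(x,s,y,z)=\frac{2}{S_0\sigma^2}\big(\frac{s-S_0}{Tx}-\omega\big)$; - gamma: $\mathrm{weight}(x,s,y,z)=\frac{4}{\sigma^4S_0^2T^2x^2}\big(s^2-2sS_0+S_0^2+\omega rT^2x^2-2rTsx+2\omega TS_0x\big)$; - vega: $\mathrm{weight}(x,s,y,z)=\frac{2}{\sigma^2T^2x^2}\big((s-S_0-(r-\sigma^2)Tx)y-\sigma^2z-\frac{\sigma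 T^2}{2}x^2\big)$. Generation of the path: $\tilde W_{t_1}=\sqrt{t_1}X_1$ and $(\tilde W_{t_2}-\tilde W_{t_1},\dots,\tilde W_{t_d}-\tilde W_{t_1})'=\boldsymbol A\boldsymbol Z$, where $X_1\sim N(0,1)$ and $\boldsymbol Z=(X_2,\dots,X_d)'\sim N(\boldsymbol 0_{d-1},\boldsymbol I_{d-1})$ are independent under $\mathbb Q$, and $\boldsymbol A$ is a $(d-1)\times(d-1)$ real matrix with $\boldsymbol A\boldsymbol A'=\boldsymbol\Sigma$, $\boldsymbol\Sigma_{ij}=t_{\min(i,j)+1}-t_1$. $\boldsymbol A_j$ is the $j$-th row of $\boldsymbol A$ and $\boldsymbol A_0=\boldsymbol 0_{d-1}'$. Set $\tilde S_j=S_0\exp(\omega(t_j-t_1)+\sigma\boldsymbol A_{j-1}\boldsymbol Z)$, so that $S_j=\exp(\omega t_1+\sigma\sqrt{t_1}X_1)\tilde S_j$; $\tilde S_A=\frac1d\sum_{j=1}^d\tilde S_j$; and $\psi_d=\frac{\ln K-\ln\tilde S_A-\omega t_1}{\sigma\sqrt{t_1}}$. $\Phi$ is the standard normal distribution function. CMV estimates for the binary Asian option (payoff $\mathbf 1\{x>K\}$), with $\Phi_3:=\Phi(-2\sigma\sqrt{t_1}-\psi_d)$ and $\Phi_1,\Phi_2,\mathsf B,\mathsf C,\mathsf D$ as defined in the claim: $$G_{\Delta,1}(K;\boldsymbol Z)=\Big(\frac{2e^{-rT}\tilde S_d}{TS_0\tilde S_A\sigma^2}-\frac{2e^{-rT}\omega}{S_0\sigma^2}\Big)\Phi_1-\frac{2e^{-rT-rt_1+\sigma^2t_1}}{T\tilde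 S_A\sigma^2}\Phi_2,$$ $$G_{\Gamma,1}(K;\boldsymbol Z)=\frac{4e^{-rT}}{\sigma^4S_0^2T^2}\Big[\Big(\frac{\tilde S_d^2}{\tilde S_A^2}+\omega rT^2-\frac{2rT\tilde S_d}{\tilde S_A}\Big)\Phi_1+\frac{S_0^2}{\tilde S_A^2}e^{-2rt_1+3\sigma^2t_1}\Phi_3+\Big(\frac{2\omega TS_0}{\tilde S_A}-\frac{2S_0\tilde S_d}{\tilde S_A^2}\Big)e^{-rt_1+\sigma^2t_1}\Phi_2\Big],$$ $$\begin{aligned}G_{\vartheta,1}(K;\boldsymbol Z)=&\ \Phi_1\Big(\frac{2e^{-rT}(\tilde S_d-(r-\sigma^2)T\tilde S_A)}{\sigma^2T\tilde S_A^2d}\mathsf B-\frac{2e^{-rT}}{d^2\tilde S_A^2}\mathsf C-\frac{e^{-rT}}{\sigma}\Big)+\Phi_2\Big(\frac{2e^{-rT}S_0\sqrt{t_1}}{\sigma^2T\tilde S_A}\sigma\sqrt{t_1}e^{\sigma^2t_1/2-\omega t_1}-\frac{2S_0e^{-rT}}{\sigma^2Td\tilde S_A^2}e^{-rt_1+\sigma^2t_1}\mathsf B\Big)\\&+\frac{1}{\sqrt{2\pi}}e^{-\psi_d^2/2}\Big(\frac{2e^{-rT}\tilde S_d\sqrt{t_1}}{\sigma^2T\tilde S_A}-\frac{2e^{-rT}}{\sigma^2}\sqrt{t_1}(r-\sigma^2)-\frac{2e^{-rT}\sqrt{t_1}}{\tilde S_A^2d^2}\mathsf D\Big)-\frac{2e^{-rT}S_0\sqrt{t_1}}{\sigma^2T\tilde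 S_A}\frac{1}{\sqrt{2\pi}}e^{\sigma^2t_1/2-\omega t_1}e^{-(\psi_d+\sigma\sqrt{t_1})^2/2}.\end{aligned}$$ *)

(* Defs.v *)
From HB Require Import structures.
From mathcomp Require Import all_boot all_order all_algebra.
From mathcomp Require Import all_classical all_reals all_analysis.

Set Implicit Arguments.
Unset Strict Implicit.
Unset Printing Implicit Defensive.

Import Order.TTheory GRing.Theory Num.Theory.
Import numFieldNormedType.Exports.

Local Open Scope classical_set_scope.
Local Open Scope ring_scope.

Section Probability.
Context {R : realType} {dm : measure_display} {Om : measurableType dm}.
Context (P : probability Om R).
Implicit Types (X Y : Om -> R) (F : set (set Om)).

Definition has_law X (mu : set R -> \bar R) : Prop :=
  forall B : set R, measurable B -> P (X @^-1` B) = mu B.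

(* For a family indexed by all of 'I_n, the product rule for finite subfamilies
   is the instance where the remaining [B i] are [setT]. *)
Definition mutually_independent n (X : 'I_n -> Om -> R) : Prop :=
  forall B : 'I_n -> set R, (forall i, measurable (B i)) ->
    P (\bigcap_(i in setT) X i @^-1` B i)
    = (\prod_(i < n) P (X i @^-1` B i))%E.

Definition independent_of X F : Prop :=
  forall (B : set R) (E : set Om), measurable B -> F E ->
    P (X @^-1` B `&` E) = (P (X @^-1` B) * P E)%E.

(* [Y] is a version of the conditional expectation of [X] given the
   sub-sigma-algebra [F]. *)
Definition is_cond_exp F X Y : Prop :=
  [/\ P.-integrable setT (EFin \o X),
      P.-integrable setT (EFin \o Y),
      forall B : set R, measurable B -> F (Y @^-1` B) &
      forall E, F E ->
        (\int[P]_(w in E) (X w)%:E = \int[P]_(w in E) (Y w)%:E)%E].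

(* [normal_prob m s] is parametrised by the standard deviation [s]. *)
Definition std_normal X : Prop := has_law X (normal_prob 0 1).

(* Standard Brownian motion on [0, T]; values outside [0, T] are irrelevant. *)
Definition brownian_motion (T : R) (W : R -> {RV P >-> R}) : Prop :=
  [/\ {ae P, forall w, W 0 w = 0},
      forall s t, 0 <= s -> s < t -> t <= T ->
        has_law (fun w => W t w - W s w) (normal_prob 0 (Num.sqrt (t - s))),
      forall n (u : nat -> R), 0 <= u 0%N ->
        (forall i, (i < n)%N -> u i <= u i.+1) -> u n <= T ->
        mutually_independent (fun (i : 'I_n) w => W (u i.+1) w - W (u i) w) &
      {ae P, forall w, {within `[0, T], continuous (fun t => W t w)}}].

End Probability.

Section StandardNormal.
Context {R : realType}.
Implicit Type x : R.

Definition Phi x : R := fine (normal_prob (0 : R) 1 `]-oo, x]).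

Definition phi0 x : R := (Num.sqrt (2 * pi))^-1 * expR (- x ^+ 2 / 2).

End StandardNormal.

Section BlackScholes.
Context {R : realType}.
Context (S0 r sigma T : R) (d : nat).

Definition drift : R := r - sigma ^+ 2 / 2.
Local Notation omega := drift.

Definition tgrid (j : nat) : R := j%:R * T / d%:R.

(* In this block [p] is a sample path of the Brownian motion. *)
Definition price (p : R -> R) (t : R) : R :=
  S0 * expR (omega * t + sigma * p t).

Definition price_avg (p : R -> R) : R :=
  d%:R^-1 * \sum_(1 <= j < d.+1) price p (tgrid j).

Definition y_stat (p : R -> R) : R :=
  T / d%:R * \sum_(1 <= j < d.+1)
    price p (tgrid j) * (p (tgrid j) - sigma * tgrid j).

Definition z_stat (p : R -> R) : R :=
  T ^+ 2 / d%:R ^+ 2 * \sum_(1 <= i < d.+1) \sum_(i <= j < d.+1)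
    price p (tgrid i) * price p (tgrid j) * (p (tgrid j) - sigma * tgrid j).

Definition weight_delta (x s y z : R) : R :=
  2 / (S0 * sigma ^+ 2) * ((s - S0) / (T * x) - omega).

Definition weight_gamma (x s y z : R) : R :=
  4 / (sigma ^+ 4 * S0 ^+ 2 * T ^+ 2 * x ^+ 2) *
  (s ^+ 2 - 2 * s * S0 + S0 ^+ 2 + omega * r * T ^+ 2 * x ^+ 2
   - 2 * r * T * s * x + 2 * omega * T * S0 * x).

Definition weight_vega (x s y z : R) : R :=
  2 / (sigma ^+ 2 * T ^+ 2 * x ^+ 2) *
  ((s - S0 - (r - sigma ^+ 2) * T * x) * y - sigma ^+ 2 * z
   - sigma * T ^+ 2 / 2 * x ^+ 2).

Definition greek_estimate (weight : R -> R -> R -> R -> R) (f : R -> R)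
    (p : R -> R) : R :=
  expR (- (r * T)) * f (price_avg p) *
  weight (price_avg p) (price p (tgrid d)) (y_stat p) (z_stat p).

Definition call_payoff (K x : R) : R := Num.max (x - K) 0.

(* Indices [i j : 'I_(d.-1)] are 0-based, hence [(minn i j).+2]. *)
Definition increment_cov : 'M[R]_(d.-1) :=
  \matrix_(i, j) (tgrid (minn i j).+2 - tgrid 1).

Context (A : 'M[R]_(d.-1)).

(* 1-based row of [A], with the convention [rowA 0 = 0]. *)
Definition rowA (k : nat) : 'rV[R]_(d.-1) :=
  if k is k'.+1 then
    if insub k' : option 'I_(d.-1) is Some i then row i A else 0
  else 0.

Context (K : R) (Z : 'cV[R]_(d.-1)).

Definition AZ (k : nat) : R := (rowA k *m Z) 0 0.

Local Notation t1 := (tgrid 1).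
Local Notation sqt1 := (Num.sqrt (tgrid 1)).

Definition tS (j : nat) : R :=
  S0 * expR (omega * (tgrid j - t1) + sigma * AZ j.-1).

Definition tSA : R := d%:R^-1 * \sum_(1 <= j < d.+1) tS j.

Definition psi : R := (ln K - ln tSA - omega * t1) / (sigma * sqt1).

Definition Phi1 : R := Phi (- psi).
Definition Phi2 : R := Phi (- (sigma * sqt1) - psi).
Definition Phi3 : R := Phi (- (2 * sigma * sqt1) - psi).
Definition tPhi2 : R := Phi (sigma * sqt1 - psi).

Definition sumB : R :=
  \sum_(1 <= j < d.+1) tS j * (AZ j.-1 - sigma * tgrid j).

Definition sumC : R :=
  \sum_(1 <= i < d.+1) \sum_(i <= j < d.+1)
    tS i * tS j * (AZ j.-1 - sigma * tgrid j).

Definition sumD : R :=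
  \sum_(1 <= i < d.+1) \sum_(i <= j < d.+1) tS i * tS j.

Local Notation dR := (d%:R : R).
Local Notation disc := (expR (- (r * T))).

Definition G_delta1 : R :=
  (2 * disc * tS d / (T * S0 * tSA * sigma ^+ 2)
   - 2 * disc * omega / (S0 * sigma ^+ 2)) * Phi1
  - 2 * expR (- (r * T) - r * t1 + sigma ^+ 2 * t1) / (T * tSA * sigma ^+ 2)
    * Phi2.

Definition G_gamma1 : R :=
  4 * disc / (sigma ^+ 4 * S0 ^+ 2 * T ^+ 2) *
  ((tS d ^+ 2 / tSA ^+ 2 + omega * r * T ^+ 2 - 2 * r * T * tS d / tSA) * Phi1
   + S0 ^+ 2 / tSA ^+ 2 * expR (- (2 * r * t1) + 3 * sigma ^+ 2 * t1) * Phi3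
   + (2 * omega * T * S0 / tSA - 2 * S0 * tS d / tSA ^+ 2)
     * expR (- (r * t1) + sigma ^+ 2 * t1) * Phi2).

Definition G_vega1 : R :=
  Phi1 *
  (2 * disc * (tS d - (r - sigma ^+ 2) * T * tSA)
     / (sigma ^+ 2 * T * tSA ^+ 2 * dR) * sumB
   - 2 * disc / (dR ^+ 2 * tSA ^+ 2) * sumC
   - disc / sigma)
  + Phi2 *
  (2 * disc * S0 * sqt1 / (sigma ^+ 2 * T * tSA) * sigma * sqt1
     * expR (sigma ^+ 2 * t1 / 2 - omega * t1)
   - 2 * S0 * disc / (sigma ^+ 2 * T * dR * tSA ^+ 2)
     * expR (- (r * t1) + sigma ^+ 2 * t1) * sumB)
  + phi0 psi *
  (2 * disc * tS d * sqt1 / (sigma ^+ 2 * T * tSA)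
   - 2 * disc / sigma ^+ 2 * sqt1 * (r - sigma ^+ 2)
   - 2 * disc * sqt1 / (tSA ^+ 2 * dR ^+ 2) * sumD)
  - 2 * disc * S0 * sqt1 / (sigma ^+ 2 * T * tSA)
    * expR (sigma ^+ 2 * t1 / 2 - omega * t1)
    * phi0 (psi + sigma * sqt1).

Definition G_delta2 : R :=
  - (2 * disc / (T * sigma ^+ 2)) * Phi1
  + (2 * disc * tS d / (T * S0 * sigma ^+ 2) * expR (r * t1)
     - 2 * disc * omega * tSA / (S0 * sigma ^+ 2) * expR (r * t1)) * tPhi2
  - K * G_delta1.

Definition G_gamma2 : R :=
  (8 * omega * disc / (sigma ^+ 4 * S0 * T)
   - 8 * disc * tS d / (sigma ^+ 4 * S0 * T ^+ 2 * tSA)) * Phi1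
  + 4 * disc / (sigma ^+ 4 * T ^+ 2 * tSA)
    * expR (- (r * t1) + sigma ^+ 2 * t1) * Phi2
  + (4 * disc * tS d ^+ 2 / (sigma ^+ 4 * S0 ^+ 2 * T ^+ 2 * tSA)
       * expR (r * t1)
     + 4 * disc * omega * r * tSA / (sigma ^+ 4 * S0 ^+ 2) * expR (r * t1)
     - 8 * r * tS d * disc / (sigma ^+ 4 * S0 ^+ 2 * T) * expR (r * t1)) * tPhi2
  - K * G_gamma1.

Definition G_vega2 : R :=
  - (2 * disc * S0 / (sigma ^+ 2 * T * tSA * dR)) * sumB * Phi1
  - K * G_vega1
  - 2 * disc * S0 * sqt1 / (sigma ^+ 2 * T) * phi0 psi
  + (2 * disc * tS d / (sigma ^+ 2 * T * tSA * dR) * sumB * expR (r * t1)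
     + (2 * disc * tS d * sqt1 / (sigma ^+ 2 * T)
        - 2 * disc * tSA / sigma ^+ 2 * sqt1 * (r - sigma ^+ 2)
        - 2 * disc * sqt1 / (tSA * dR ^+ 2) * sumD)
       * sigma * sqt1 * expR (sigma ^+ 2 * t1 / 2 + omega * t1)
     - 2 * disc * (r - sigma ^+ 2) / (sigma ^+ 2 * dR) * sumB * expR (r * t1)
     - 2 * disc / (dR ^+ 2 * tSA) * sumC * expR (r * t1)
     - tSA * disc / sigma * expR (r * t1)) * tPhi2
  + (2 * disc * tS d * sqt1 / (sigma ^+ 2 * T)
     - 2 * disc * tSA / sigma ^+ 2 * sqt1 * (r - sigma ^+ 2)
     - 2 * disc * sqt1 / (tSA * dR ^+ 2) * sumD)
    * ((Num.sqrt (2 * pi))^-1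
       * expR (sigma ^+ 2 * t1 / 2 + omega * t1
               - (psi - sigma * sqt1) ^+ 2 / 2)).

End BlackScholes.

(* Main.v *)
Require Import Defs.
From HB Require Import structures.
From mathcomp Require Import all_boot all_order all_algebra.
From mathcomp Require Import all_classical all_reals all_analysis.
From mathcomp Require Import measurable_realfun.
From mathcomp Require Import ring lra.

Import Order.TTheory GRing.Theory Num.Theory.
Import numFieldNormedType.Exports.

Local Open Scope classical_set_scope.
Local Open Scope ring_scope.

(** Write [t1 = tgrid T d 1], [s = sigma * sqrt t1], [omega = r - sigma^2 / 2]
    and [E = exp (omega * t1 + s * X1)]. On the grid the path is
    [sqrt t1 * X1] plus a function of [Z], so the price at the [j]-th grid point
    is [E * tS j], the average is [E * tSA], and [y_stat], [z_stat] are [E] and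
    [E ^ 2] times functions that are affine in [X1] with coefficients depending
    on [Z] only. Moreover the call is in the money exactly when [psi < X1],
    where [psi] depends on [Z] only ([psi_lt], [greek_estimateE]). Sorting by
    powers of [E], the payoff times each of the three weights is therefore a
    finite sum of terms
      [c(Z) * X1^k * exp (a * X1) * 1{psi(Z) < X1}]
    with [k] in {0, 1} and [a] in {s, 0, -s, -2s}.

    As [X1] is independent of [Z], the conditional expectation of such a term is
    obtained by freezing [Z] and integrating over the law of [X1]
    ([is_cond_exp_freezing], a consequence of Fubini for the product of the law
    of [X1] with the restriction of the probability to the sigma-algebra of
    [Z]). What is left are truncated exponential moments of a standard normal
    variable, computed by completing the square ([gauss_exp_tail]) and, when
    [k = 1], by the fundamental theorem of calculus ([gauss_Xexp_tail]). Their
    sum is the announced closed formula: this is where [Phi1], [Phi2], [Phi3],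
    [tPhi2] and the Gaussian densities come from.

    Integrability holds because every coefficient [c(Z)] grows at most
    exponentially in [sum_i |Z_i|] and each [Z_i] has exponential moments of all
    orders ([integrable_exp_bounded]); the negative powers of [tSA] are harmless
    since [tSA >= S0 / d], its first summand being [S0] ([tSA_ge]). *)

(** * Truncated exponential moments of the standard normal law *)

Section NormalIntegrals.
Context {R : realType}.
Local Notation mu := (@lebesgue_measure R).
Implicit Types (a x u m s : R).

(** By construction [normal_prob] integrates [normal_pdf], so the latter is almost
    everywhere its Radon-Nikodym derivative; this settles nonnegative integrands,
    and a signed integral is the difference of those of the positive and the
    negative part. *)
Lemma integral_normal_prob m s (f : R -> \bar R) (D : set R) :
  measurable D -> measurable_fun D f ->
  (\int[normal_prob m s]_(x in D) f x
   = \int[mu]_(x in D) (f x * (normal_pdf m s x)%:E))%E.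
Proof.
have nonneg (g : R -> \bar R) : measurable D -> measurable_fun D g ->
    (forall x, (0 <= g x)%E) ->
    (\int[normal_prob m s]_(x in D) g x
     = \int[mu]_(x in D) (g x * (normal_pdf m s x)%:E))%E.
  move=> mD mg g0.
  rewrite -(Radon_Nikodym_SigmaFinite.change_of_variables
             (normal_prob_dominates m s) g0 mD mg).
  have RNi := Radon_Nikodym_SigmaFinite.f_integrable
                (normal_prob_dominates m s).
  have mRN := measurable_int _ RNi.
  have mpdf : measurable_fun D (fun x => (normal_pdf m s x)%:E).
    apply/measurable_EFinP/measurable_funTS; exact: measurable_normal_pdf.
  apply: ae_eq_integral => //.
  - by apply: emeasurable_funM => //; exact: measurable_funTS.
  - exact: emeasurable_funM.
  apply: ae_eqe_mul2l; apply: integral_ae_eq => //.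
    by apply: integrableS RNi.
  by move=> E _ mE; rewrite -Radon_Nikodym_SigmaFinite.f_integral//;
    exact: normal_prob_dominates.
move=> mD mf.
rewrite integralE (nonneg (f^\+)%E)//; last exact: measurable_funepos.
rewrite (nonneg (f^\-)%E)//; last exact: measurable_funeneg.
rewrite [RHS]integralE; congr (_ - _)%E; apply: eq_integral => x _.
  by rewrite funeposE funeposE maxe_pMl ?mul0e ?lee_fin ?normal_pdf_ge0.
by rewrite funenegE funenegE maxe_pMl ?mul0e ?mulNe ?lee_fin ?normal_pdf_ge0.
Qed.

Lemma lebesgue_measure_reflect a (A : set (measurableTypeR R)) : measurable A ->
  pushforward mu (fun x : measurableTypeR R => a - x : measurableTypeR R) A
  = mu A.
Proof.
move=> mA; apply/esym/lebesgue_measure_unique => //=.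
  exact: measurable_funB.
move=> mf _ [[b c]] _ <-.
rewrite /pushforward.
have -> : (fun x : R => a - x) @^-1` [set` `]b, c]] = `[a - c, a - b[%classic.
  apply/seteqP; split=> x /=; rewrite !in_itv/= => /andP[h1 h2];
    apply/andP; split; lra.
rewrite /= !lebesgue_measure_itv/= !lte_fin.
have -> : (a - c < a - b) = (b < c) by lra.
by case: ifP => // _; rewrite -!EFinB; congr EFin; ring.
Qed.

Lemma normal_pdf1E m x : normal_pdf m 1 x = phi0 (x - m).
Proof.
rewrite normal_pdfE ?oner_neq0// /phi0 /normal_peak /normal_fun expr1n mul1r.
by rewrite mulr_natl.
Qed.

Lemma normal_pdf_reflect a x : normal_pdf a 1 x = normal_pdf 0 1 (a - x).
Proof.
rewrite (normal_pdf1E a) (normal_pdf1E 0) /phi0 (subr0 (a - x)).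
by rewrite -(sqrrN (x - a)) opprB.
Qed.

(** The substitution [x -> a - x] preserves Lebesgue measure and turns the upper
    tail of the law centered at [a] into a lower tail of the centered one. *)
Lemma normal_prob_upper_tail a u :
  normal_prob a 1 `]u, +oo[ = (Phi (a - u))%:E.
Proof.
rewrite /Phi fineK; last exact: fin_num_measure.
rewrite /normal_prob.
rewrite integral_itv_obnd_cbnd; last first.
  apply/measurable_EFinP/measurable_funTS; exact: measurable_normal_pdf.
transitivity (\int[pushforward mu (fun x : measurableTypeR R =>
   (a - x)%R : measurableTypeR R)]_(x in `]-oo, (a - u)%R]) (normal_pdf 0 1 x)%:E)%E.
  rewrite ge0_integral_pushforward.
  - have -> : (fun x : R => a - x) @^-1` [set` `]-oo, a - u]]
             = `[u, +oo[%classic.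
      apply/seteqP; split=> x /=; rewrite !in_itv/= ?andbT; lra.
    by apply: eq_integral => x _; rewrite normal_pdf_reflect.
  - exact: measurable_funB.
  - by [].
  - apply/measurable_EFinP/measurable_funTS; exact: measurable_normal_pdf.
  - by move=> x _; rewrite lee_fin normal_pdf_ge0.
apply: eq_measure_integral => [|mf A mA _]; first exact: measurable_funB.
exact: lebesgue_measure_reflect.
Qed.

(** Completing the square: an exponential weight recenters the Gaussian. *)
Lemma normal_pdf_tilt a x :
  expR (a * x) * normal_pdf 0 1 x = expR (a ^+ 2 / 2) * normal_pdf a 1 x.
Proof.
rewrite (normal_pdf1E a) (normal_pdf1E 0) /phi0 !(mulrCA (expR _)) -!expRD.
congr (_ * expR _).
by field.
Qed.

Lemma measurable_expRM a : measurable_fun [set: R] (fun x => expR (a * x)).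
Proof. by apply: measurableT_comp => //; exact: measurable_funM. Qed.

Lemma integral_expR_tilt a (g : R -> R) (D : set R) :
  measurable D -> measurable_fun D g ->
  (\int[normal_prob (0 : R) 1]_(x in D) (g x * expR (a * x))%:E
   = \int[mu]_(x in D) ((expR (a ^+ 2 / 2) * g x) * normal_pdf a 1 x)%:E)%E.
Proof.
move=> mD mg; rewrite integral_normal_prob//; last first.
  apply/measurable_EFinP; apply: measurable_funM => //.
  by apply: measurable_funTS; exact: measurable_expRM.
apply: eq_integral => x _; rewrite -EFinM; congr EFin.
by rewrite -(mulrA (g x)) normal_pdf_tilt; ring.
Qed.

Lemma normal_exp_tail a u :
  (\int[normal_prob (0 : R) 1]_(x in `]u, +oo[) (expR (a * x))%:E
   = (expR (a ^+ 2 / 2) * Phi (a - u))%:E)%E.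
Proof.
under eq_integral do rewrite -[expR _]mul1r.
rewrite integral_expR_tilt//.
under eq_integral do rewrite mulr1 EFinM.
rewrite ge0_integralZl//; last 2 first.
- apply/measurable_EFinP/measurable_funTS; exact: measurable_normal_pdf.
- by move=> x _; rewrite lee_fin normal_pdf_ge0.
by rewrite EFinM -normal_prob_upper_tail.
Qed.

Lemma normal_exp_integrable a :
  (normal_prob (0 : R) 1).-integrable setT (fun x => (expR (a * x))%:E).
Proof.
apply/integrableP; split.
  by apply/measurable_EFinP; exact: measurable_expRM.
under eq_integral do rewrite gee0_abs ?lee_fin ?expR_ge0// -[expR _]mul1r.
rewrite integral_expR_tilt//.
under eq_integral do rewrite mulr1 EFinM.
rewrite ge0_integralZl//; last 2 first.
- apply/measurable_EFinP; exact: measurable_normal_pdf.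
- by move=> x _; rewrite lee_fin normal_pdf_ge0.
by rewrite integral_normal_pdf mule1 ltry.
Qed.

Lemma normr_le_expR x : `|x| <= expR x + expR (- x).
Proof.
have h1 := expR_ge1Dx x; have h2 := expR_ge1Dx (- x).
have h3 := expR_ge0 x; have h4 := expR_ge0 (- x).
by rewrite ler_norml; apply/andP; split; lra.
Qed.

Lemma normal_Xexp_integrable a :
  (normal_prob (0 : R) 1).-integrable setT (fun x => (x * expR (a * x))%:E).
Proof.
apply: (le_integrable measurableT _ _
  (integrableD measurableT (normal_exp_integrable (a + 1))
                           (normal_exp_integrable (a - 1)))).
  apply/measurable_EFinP; apply: measurable_funM => //.
  exact: measurable_expRM.
move=> x _ /=; rewrite lee_fin normrM (ger0_norm (expR_ge0 _)).
rewrite (ger0_norm (addr_ge0 (expR_ge0 _) (expR_ge0 _))).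
apply: (@le_trans _ _ ((expR x + expR (- x)) * expR (a * x))).
  by rewrite ler_wpM2r ?expR_ge0 ?normr_le_expR.
rewrite mulrDl -!expRD le_eqVlt; apply/orP; left; apply/eqP.
by congr (expR _ + expR _); ring.
Qed.

End NormalIntegrals.

Section NormalPartialMoment.
Context {R : realType}.
Local Notation mu := (@lebesgue_measure R).
Implicit Types (a c x u M : R).

Lemma is_derive_normal_pdf c a x :
  is_derive x 1 (fun x => - (c * normal_pdf a 1 x))
    (c * (x - a) * normal_pdf a 1 x).
Proof.
have -> : (fun x => - (c * normal_pdf a 1 x))
          = (fun x => - (c * (Num.sqrt (2 * pi))^-1)
                       *: expR (- (2^-1) *: (x - a) ^+ 2)).
  apply/funext => y; rewrite (normal_pdf1E a) /phi0.
  rewrite (_ : - (2^-1) *: (y - a) ^+ 2 = - (y - a) ^+ 2 / 2); last first.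
    by rewrite /GRing.scale/=; ring.
  by rewrite /GRing.scale/=; ring.
apply: is_derive_eq.
rewrite (normal_pdf1E a) /phi0.
rewrite (_ : - (2^-1) *: (x - a) ^+ 2 = - (x - a) ^+ 2 / 2); last first.
  by rewrite /GRing.scale/=; ring.
rewrite /GRing.scale/= subr0.
by set k := (Num.sqrt _)^-1; set E := expR _; field.
Qed.

Lemma cvg_normal_pdf_pinfty a : normal_pdf a 1 x @[x --> +oo] --> (0 : R).
Proof.
pose b : R := (Num.sqrt 2)^-1.
have b0 : 0 < b by rewrite invr_gt0 sqrtr_gt0.
have -> : normal_pdf a 1
          = (fun x => (Num.sqrt (2 * pi))^-1 * gauss_fun ((x - a) * b)).
  apply/funext => x; rewrite (normal_pdf1E a) /phi0 /gauss_fun exprMn /b exprVn.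
  by rewrite sqr_sqrtr// mulNr.
rewrite -[0 in X in _ --> X](mulr0 (Num.sqrt (2 * pi))^-1).
apply: cvgM; first exact: cvg_cst.
apply: (cvg_comp (fun x => (x - a) * b) _ _ cvg_gauss_fun).
by apply: gt0_cvgMly => //; exact: cvg_addrr.
Qed.

(** The integrand is the derivative of [- c * normal_pdf a 1], which vanishes at
    infinity. It changes sign at [a], so the half-line is cut at some [M >= a]:
    compact fundamental theorem before [M], nonnegative version after it. *)
Lemma integral_centered_normal_pdf c a u : 0 <= c ->
  (\int[mu]_(x in `]u, +oo[) (c * (x - a) * normal_pdf a 1 x)%:E
   = (c * phi0 (u - a))%:E)%E.
Proof.
move=> c0; rewrite -(normal_pdf1E a).
set f := fun x => c * (x - a) * normal_pdf a 1 x.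
pose F x := - (c * normal_pdf a 1 x).
have dF x : is_derive x 1 F (f x) by exact: is_derive_normal_pdf.
have Fd x : derivable F x 1 by have [] := dF x.
have F'f x : F^`()%classic x = f x by rewrite derive1E derive_val.
have cF : continuous F.
  by move=> x; apply/differentiable_continuous/derivable1_diffP/Fd.
have cf : continuous f.
  move=> x; apply: cvgM; last by apply: continuous_normal_pdf; exact: oner_neq0.
  apply: cvgM; first exact: cvg_cst.
  by apply: cvgB; [exact: cvg_id|exact: cvg_cst].
have mf (D : set R) : measurable D -> measurable_fun D (EFin \o f).
  move=> mD; apply/measurable_EFinP; apply: measurable_funTS.
  exact: continuous_measurable_fun.
pose M := Num.max u a + 1.
have uM : u < M by rewrite ltr_pwDr// le_max lexx.
have aM : a <= M by rewrite ltW// ltr_pwDr// le_max lexx orbT.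
rewrite integral_itv_obnd_cbnd; last exact: mf.
rewrite (@itv_bndbnd_setU _ _ _ (BRight M))//=; last by rewrite bnd_simp ltW.
rewrite integral_setU//=; last 2 first.
- by apply: mf; exact: measurableU.
- apply/disj_setPS => x [] /=; rewrite !in_itv/= => /andP[_ xM] /andP[Mx _].
  by move: (le_lt_trans xM Mx); rewrite ltxx.
rewrite integral_itv_obnd_cbnd; last exact: mf.
rewrite (continuous_FTC2 (F := F))//; last 2 first.
- exact: continuous_subspaceT.
- split=> [x _||]; [exact: Fd|exact: cvg_at_right_filter (cF u)
    |exact: cvg_at_left_filter (cF M)].
rewrite (ge0_continuous_FTC2y (F := F) (l := 0))//; last 4 first.
- move=> x Mx; rewrite mulr_ge0 ?normal_pdf_ge0// mulr_ge0// subr_ge0.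
  exact: le_trans Mx.
- exact: continuous_subspaceT.
- rewrite /F -[0 in X in _ --> X]oppr0 -[0 in X in _ --> X](mulr0 c).
  by apply: cvgN; apply: cvgM; [exact: cvg_cst|exact: cvg_normal_pdf_pinfty].
- exact: cvg_at_right_filter (cF M).
by rewrite -!EFinD; congr EFin; rewrite /F; ring.
Qed.

(** Decompose [x = a + (x - a)]: after tilting, the first term is a tail
    probability and the second one is an exact derivative. *)
Lemma normal_Xexp_tail a u :
  (\int[normal_prob (0 : R) 1]_(x in `]u, +oo[) (x * expR (a * x))%:E
   = (expR (a ^+ 2 / 2) * (a * Phi (a - u) + phi0 (u - a)))%:E)%E.
Proof.
have mI : measurable `]u, +oo[ by exact: measurable_itv.
have ie : (normal_prob (0 : R) 1).-integrable `]u, +oo[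
    (fun x => (a * expR (a * x))%:E).
  apply: (integrableS measurableT) => //.
  by under eq_fun do rewrite EFinM; apply: integrableZl => //;
    exact: normal_exp_integrable.
have iX : (normal_prob (0 : R) 1).-integrable `]u, +oo[
    (fun x => (x * expR (a * x))%:E).
  by apply: (integrableS measurableT) => //; exact: normal_Xexp_integrable.
have -> : (fun x : R => (x * expR (a * x))%:E)
    = (fun x => ((a * expR (a * x))%:E + ((x - a) * expR (a * x))%:E)%E).
  by apply/funext => x; rewrite -EFinD; congr EFin; ring.
rewrite integralD//; last first.
  have -> : (fun x : R => ((x - a) * expR (a * x))%:E)
      = (fun x => ((x * expR (a * x))%:E - (a * expR (a * x))%:E)%E).
    by apply/funext => x; rewrite -EFinB; congr EFin; ring.
  exact: integrableB.
rewrite [X in (_ + X)%E]integral_expR_tilt//; last first.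
  by apply: measurable_funTS; exact: measurable_funB.
rewrite integral_centered_normal_pdf ?expR_ge0//.
under eq_integral do rewrite EFinM.
rewrite integralZl//; last first.
  by apply: (integrableS measurableT) => //; exact: normal_exp_integrable.
by rewrite normal_exp_tail -EFinM -EFinD; congr EFin; ring.
Qed.

End NormalPartialMoment.

Section Gauss.
Context {R : realType}.
Implicit Types (a u : R).

Local Notation idR := (idfun : measurableTypeR R -> R).

Let idR_measurable : measurable_fun [set: measurableTypeR R] idR.
Proof. by move=> _ B mB; rewrite setTI. Qed.

Let idRV : {RV (normal_prob (0 : R) 1) >-> R} :=
  HB.pack idR (isMeasurableFun.Build _ _ _ _ _ idR_measurable).

(** [normal_prob] is a measure for the sigma-algebra generated by the half-open
    intervals; [gauss] is the same set function, as a probability for the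
    canonical Borel structure on [R], the one random variables take values in. *)
Definition gauss : probability R R := distribution (normal_prob (0 : R) 1) idRV.

Lemma std_normal_gauss {d} {Om : measurableType d} {P : probability Om R}
  {X : Om -> R} : std_normal P X -> has_law P X gauss.
Proof. by []. Qed.

Let gauss_integrable (f : R -> R) : measurable_fun [set: R] f ->
  (normal_prob (0 : R) 1).-integrable setT (EFin \o f) ->
  gauss.-integrable setT (EFin \o f).
Proof.
move=> mf fi; apply: integrable_pushforward => //; exact/measurable_EFinP.
Qed.

Let gauss_integral (f : R -> R) (D : set R) : measurable_fun [set: R] f ->
  measurable D -> (normal_prob (0 : R) 1).-integrable setT (EFin \o f) ->
  (\int[gauss]_(x in D) (f x)%:E
   = \int[normal_prob (0 : R) 1]_(x in D) (f x)%:E)%E.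
Proof.
move=> mf mD fi; rewrite integral_pushforward//; first exact/measurable_EFinP.
exact: (integrableS measurableT).
Qed.

Lemma gauss_exp_integrable a :
  gauss.-integrable setT (EFin \o (fun x => expR (a * x))).
Proof.
apply: gauss_integrable; first exact: measurable_expRM.
exact: normal_exp_integrable.
Qed.

Let measurable_XexpR a : measurable_fun [set: R] (fun x => x * expR (a * x)).
Proof. by apply: measurable_funM => //; exact: measurable_expRM. Qed.

Lemma gauss_Xexp_integrable a :
  gauss.-integrable setT (EFin \o (fun x => x * expR (a * x))).
Proof. by apply: gauss_integrable => //; exact: normal_Xexp_integrable. Qed.

Lemma gauss_exp_tail a u :
  (\int[gauss]_(x in `]u, +oo[) (expR (a * x))%:E
   = (expR (a ^+ 2 / 2) * Phi (a - u))%:E)%E.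
Proof.
rewrite gauss_integral ?normal_exp_tail//; first exact: measurable_expRM.
exact: normal_exp_integrable.
Qed.

Lemma gauss_Xexp_tail a u :
  (\int[gauss]_(x in `]u, +oo[) (x * expR (a * x))%:E
   = (expR (a ^+ 2 / 2) * (a * Phi (a - u) + phi0 (u - a)))%:E)%E.
Proof.
rewrite gauss_integral ?normal_Xexp_tail//; exact: normal_Xexp_integrable.
Qed.

End Gauss.

(** * Conditional expectation by freezing an independent variable *)

Section ConditionalExpectation.
Context {R : realType} {dm : measure_display} {Om : measurableType dm}.
Context (P : probability Om R) (C : set (set Om)).
Hypothesis Cm : <<s C >> `<=` measurable.

Local Notation OmC := (g_sigma_algebraType C).

Let idC_measurable : measurable_fun [set: Om] (idfun : Om -> OmC).
Proof. by move=> _ B mB; rewrite setTI; exact: Cm. Qed.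

Lemma measurable_coarsen (Y : OmC -> R) :
  measurable_fun [set: OmC] Y -> measurable_fun [set: Om] (Y : Om -> R).
Proof. by move=> mY; exact: (measurableT_comp mY idC_measurable). Qed.

Lemma sigma_measurableP (Y : OmC -> R) :
  measurable_fun [set: OmC] Y <->
  (forall B : set R, measurable B -> <<s C >> (Y @^-1` B)).
Proof.
split=> [mY B mB|mY _ B mB]; last by rewrite setTI; exact: mY.
by rewrite -[X in <<s C >> X]setTI; exact: mY.
Qed.

Lemma is_cond_expD (X X' Y Y' : Om -> R) :
  is_cond_exp P <<s C >> X Y -> is_cond_exp P <<s C >> X' Y' ->
  is_cond_exp P <<s C >> (fun w => X w + X' w) (fun w => Y w + Y' w).
Proof.
have intD (f g : Om -> R) : P.-integrable setT (EFin \o f) ->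
    P.-integrable setT (EFin \o g) ->
    P.-integrable setT (EFin \o (fun w => f w + g w)).
  by move=> fi gi; have := integrableD measurableT fi gi.
have integD (f g : Om -> R) E : measurable E ->
    P.-integrable setT (EFin \o f) -> P.-integrable setT (EFin \o g) ->
    (\int[P]_(w in E) (f w + g w)%:E
     = \int[P]_(w in E) (f w)%:E + \int[P]_(w in E) (g w)%:E)%E.
  move=> mE fi gi; under eq_integral do rewrite EFinD.
  by rewrite integralD//; [exact: (integrableS measurableT _ _ fi)
    |exact: (integrableS measurableT _ _ gi)].
move=> [iX iY mY XY] [iX' iY' mY' XY'].
split; [exact: intD|exact: intD| |].
  apply/sigma_measurableP; apply: measurable_funD; exact/sigma_measurableP.
move=> E FE; have mE := Cm _ FE.
by rewrite !integD// XY// XY'.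
Qed.

Variables (X : {RV P >-> R}) (mu : probability R R).
Hypothesis Xmu : has_law P X mu.
Hypothesis XC : independent_of P X <<s C >>.

Let idC : {RV P >-> OmC} := HB.pack (idfun : Om -> OmC)
  (isMeasurableFun.Build _ _ _ _ _ idC_measurable).

Let pairXC (w : Om) : OmC * R := (idC w, X w).

Let pairXC_measurable : measurable_fun setT pairXC.
Proof. by apply: measurable_fun_pair => //; exact: measurable_funPT. Qed.

Let pairRV : {RV P >-> (OmC * R)%type} := HB.pack pairXC
  (isMeasurableFun.Build _ _ _ _ _ pairXC_measurable).

(** Independence says that the law of [w |-> (w, X w)], with [w] seen through the
    coarse sigma-algebra, agrees with the product measure on rectangles. *)
Let joint_law (A : set (OmC * R)) : measurable A ->
  (distribution P idC \x mu)%E A = distribution P pairRV A.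
Proof.
move=> mA; apply: product_measure_unique => // B E mB mE.
rewrite /= -(Xmu E mE) muleC -XC//; congr (P _).
by apply/seteqP; split=> w [].
Qed.

(** Transport the integral to the product space and apply Fubini. *)
Lemma integral_freezing (h : OmC * R -> R) (Y : OmC -> R) :
  measurable_fun setT h ->
  P.-integrable setT (fun w => (h (w, X w))%:E) ->
  (forall w, (\int[mu]_x (h (w, x))%:E = (Y w)%:E)%E) ->
  [/\ measurable_fun setT Y,
      P.-integrable setT (fun w => (Y w)%:E) &
      (\int[P]_w (h (w, X w))%:E = \int[P]_w (Y w)%:E)%E].
Proof.
move=> mh ih hY.
have mh' : measurable_fun setT (EFin \o h) by exact/measurable_EFinP.
have iprod : (distribution P idC \x mu)%E.-integrable setT (EFin \o h).
  apply/integrableP; split => //.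
  rewrite (eq_measure_integral (distribution P pairRV)); last first.
    by move=> A mA _; exact: joint_law.
  rewrite ge0_integral_distribution//; last exact: measurableT_comp.
  by have /integrableP[] := ih.
have YE : (fun w => (Y w)%:E) = fubini_F mu (EFin \o h).
  by apply/funext => w; rewrite /fubini_F -hY.
have mY : measurable_fun setT Y.
  by apply/measurable_EFinP; rewrite [_ \o _]YE; exact: measurable_fubini_F iprod.
have iY : (distribution P idC).-integrable setT (EFin \o Y).
  by rewrite [_ \o _]YE; exact: integrable_fubini_F.
have iYP : P.-integrable setT (fun w => (Y w)%:E).
  apply/integrableP; split.
    by apply/measurable_EFinP; exact: measurable_coarsen.
  have /integrableP[_] := iY.
  rewrite ge0_integral_distribution//.
  by apply: measurableT_comp => //; exact/measurable_EFinP.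
split=> //.
transitivity (\int[distribution P pairRV]_z (EFin \o h) z)%E.
  by rewrite integral_distribution.
rewrite -(eq_measure_integral _ (m1 := (distribution P idC \x mu)%E)); last first.
  by move=> A mA _; exact: joint_law.
rewrite -integral12_prod_meas1// -YE.
by rewrite integral_distribution//; exact/measurable_EFinP.
Qed.

(** Multiplying [h] by the indicator of an event of the sigma-algebra keeps it a
    function of [(w, X w)], which reduces integrals over events to full ones. *)
Lemma is_cond_exp_freezing (h : OmC * R -> R) (Y : OmC -> R) :
  measurable_fun setT h ->
  P.-integrable setT (fun w => (h (w, X w))%:E) ->
  (forall w, (\int[mu]_x (h (w, x))%:E = (Y w)%:E)%E) ->
  is_cond_exp P <<s C >> (fun w => h (w, X w)) Y.
Proof.
move=> mh ih hY; have [mY iY _] := integral_freezing h Y mh ih hY.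
split=> //; first exact/sigma_measurableP.
move=> E FE; have mE := Cm _ FE.
have mE1 : measurable_fun [set: OmC] (\1_E : OmC -> R).
  by apply: measurable_indic.
pose hE (z : OmC * R) : R := h z * \1_E z.1.
have restrE (f : Om -> R) :
    ((fun w => (f w)%:E) \_ E)%E = (fun w => (f w * \1_E w)%:E).
  apply/funext => w; rewrite patchE indicE.
  by case: ifP => _; rewrite ?mulr1 ?mulr0.
rewrite integral_mkcond [RHS]integral_mkcond !restrE.
have [] // := integral_freezing hE (fun w => Y w * \1_E w).
- by apply: measurable_funM => //; exact: measurableT_comp.
- rewrite -(restrE (fun w => h (w, X w))).
  by apply/integrable_restrict => //; rewrite setTI; exact: integrableS ih.
- move=> w; rewrite /hE/= indicE; case: (w \in E).
    by under eq_integral do rewrite mulr1; rewrite mulr1 hY.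
  by under eq_integral do rewrite mulr0; rewrite mulr0 integral0.
Qed.

(** The integral of the modulus factorizes over the product measure. *)
Lemma integrable_indepM (c : OmC -> R) (g : R -> R) :
  measurable_fun [set: OmC] c -> P.-integrable setT (EFin \o c) ->
  mu.-integrable setT (EFin \o g) ->
  P.-integrable setT (fun w => (c w * g (X w))%:E).
Proof.
move=> mc ic ig; have mg : measurable_fun setT g.
  by apply/measurable_EFinP; exact: measurable_int ig.
have mcg : measurable_fun setT (fun z : OmC * R => c z.1 * g z.2).
  by apply: measurable_funM; exact: measurableT_comp.
have mabs : measurable_fun setT (fun z : OmC * R => `|(c z.1 * g z.2)%:E|%E).
  by apply: measurableT_comp => //; exact/measurable_EFinP.
have mcg' : measurable_fun setT (fun w : Om => c w * g (X w)).
  by apply: measurable_funM; [exact: measurable_coarsen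
    |exact: measurableT_comp].
apply/integrableP; split; first exact/measurable_EFinP.
have <- : (\int[distribution P pairRV]_z `|(c z.1 * g z.2)%:E|
    = \int[P]_w `|(c w * g (X w))%:E|)%E by rewrite ge0_integral_distribution.
rewrite -(eq_measure_integral _ (m1 := (distribution P idC \x mu)%E)); last first.
  by move=> A mA _; exact: joint_law.
rewrite fubini_tonelli1//.
have [_ gfin] := integrableP _ _ _ ig; have [_ cfin] := integrableP _ _ _ ic.
pose k := (\int[mu]_x `|(g x)%:E|)%E.
have k0 : (0 <= k)%E by exact: integral_ge0.
have kfin : (k \is a fin_num)%E by rewrite ge0_fin_numE.
have -> : (\int[distribution P idC]_w
    fubini_F mu (fun z => `|(c z.1 * g z.2)%:E|) w
    = \int[distribution P idC]_w (`|(c w)%:E| * k))%E.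
  apply: eq_integral => w _; rewrite /fubini_F/=.
  under eq_integral do rewrite normrM EFinM.
  by rewrite ge0_integralZl//; apply/measurable_EFinP; exact: measurableT_comp.
rewrite ge0_integral_distribution//=; last 2 first.
- apply: emeasurable_funM => //; apply/measurable_EFinP.
  exact: measurableT_comp.
- by move=> w; exact: mule_ge0.
rewrite ge0_integralZr//; last first.
  by apply/measurable_EFinP; apply: measurableT_comp => //;
    exact: measurable_coarsen.
by rewrite lte_mul_pinfty// ?integral_ge0// ge0_fin_numE// integral_ge0.
Qed.

(** The form of freezing used for options: [g] is evaluated at the independent
    variable on the event that it exceeds a known threshold. *)
Lemma is_cond_exp_tail (c u : OmC -> R) (g G : R -> R) :
  measurable_fun [set: OmC] c -> P.-integrable setT (EFin \o c) ->
  measurable_fun [set: OmC] u ->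
  mu.-integrable setT (EFin \o g) ->
  (forall v, (\int[mu]_(x in `]v, +oo[) (g x)%:E = (G v)%:E)%E) ->
  is_cond_exp P <<s C >> (fun w => c w * g (X w) * (u w < X w)%R%:R)
                         (fun w => c w * G (u w)).
Proof.
move=> mc ic m_u ig gG.
have mg : measurable_fun setT g.
  by apply/measurable_EFinP; exact: measurable_int ig.
have ivE (w : OmC) (x : R) :
    (u w < x)%R%:R = \1_(`]u w, +oo[%classic : set R) x :> R.
  by rewrite indicE mem_setE in_itv/= andbT.
have mcu : measurable_fun setT (fun z : OmC * R => (u z.1 < z.2)%R%:R : R).
  have mA : measurable [set z : OmC * R | u z.1 < z.2].
    rewrite -[X in measurable X]setTI.
    by apply: (@measurable_fun_ltr _ _ _ setT (u \o fst) snd _ _ _ [set true]) => //;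
      exact: measurableT_comp.
  have := @measurable_indic _ _ R setT _ mA.
  apply: eq_measurable_fun => z _; rewrite indicE.
  by rewrite (_ : (z \in _) = (u z.1 < z.2))//; apply/idP/idP; rewrite inE.
pose h (z : OmC * R) := c z.1 * g z.2 * (u z.1 < z.2)%R%:R.
apply: (is_cond_exp_freezing h).
- by apply: measurable_funM => //; apply: measurable_funM;
    exact: measurableT_comp.
- apply: le_integrable (integrable_indepM c g mc ic ig) => //.
    apply/measurable_EFinP.
    have := measurableT_comp (f := h) _ pairXC_measurable; apply.
    by apply: measurable_funM => //; apply: measurable_funM;
      exact: measurableT_comp.
  move=> w _; rewrite /h/= lee_fin normrM ler_piMr//.
  by case: (_ < _); rewrite ?normr1 ?normr0.
move=> w; rewrite /h/=.
transitivity ((c w)%:E * \int[mu]_x ((g x)%:E * (\1_(`]u w, +oo[%classic : set R) x)%:E))%E.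
  under eq_integral do rewrite ivE -mulrA EFinM EFinM.
  rewrite integralZl//.
  apply: le_integrable ig => //.
    by apply: emeasurable_funM; apply/measurable_EFinP.
  move=> x _; rewrite -EFinM lee_fin normrM ler_piMr// indicE.
  by case: (_ \in _); rewrite ?normr1 ?normr0.
rewrite EFinM -gG; congr (_ * _)%E.
rewrite [RHS]integral_mkcond; apply: eq_integral => x _.
by rewrite patchE indicE; case: ifP => _; rewrite ?mule1 ?mule0.
Qed.
End ConditionalExpectation.

(** * Functions of exponential growth *)

Section ExponentialGrowth.
Context {R : realType} {d : measure_display} {Om : measurableType d}.
Context (N : Om -> R).
Hypothesis N0 : forall w, 0 <= N w.
Implicit Types (f g : Om -> R) (s : seq nat).

(** These functions form an algebra, contain the exponentials of functions
    dominated by a multiple of [N], and are integrable as soon as [N] has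
    exponential moments of all orders. *)
Definition exp_bounded f : Prop :=
  measurable_fun [set: Om] f /\
  exists M a, [/\ 0 <= M, 0 <= a & forall w, `|f w| <= M * expR (a * N w)].

Lemma exp_bounded_bounded f M : measurable_fun [set: Om] f ->
  (forall w, `|f w| <= M) -> exp_bounded f.
Proof.
move=> mf fM; split=> //; exists `|M|, 0; split=> // w.
by rewrite mul0r expR0 mulr1 (le_trans (fM w))// ler_norm.
Qed.

Lemma exp_bounded_cst k : exp_bounded (fun=> k).
Proof. by apply: (@exp_bounded_bounded _ `|k|) => //; exact: measurable_cst. Qed.

Lemma exp_boundedM f g :
  exp_bounded f -> exp_bounded g -> exp_bounded (fun w => f w * g w).
Proof.
move=> [mf [M [a [M0 a0 fM]]]] [mg [M' [a' [M'0 a'0 gM]]]].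
split; first exact: measurable_funM.
exists (M * M'), (a + a'); split; rewrite ?mulr_ge0 ?addr_ge0// => w.
by rewrite normrM mulrDl expRD mulrACA ler_pM.
Qed.

Lemma exp_boundedD f g :
  exp_bounded f -> exp_bounded g -> exp_bounded (fun w => f w + g w).
Proof.
move=> [mf [M [a [M0 a0 fM]]]] [mg [M' [a' [M'0 a'0 gM]]]].
split; first exact: measurable_funD.
exists (M + M'), (a + a'); split; rewrite ?addr_ge0// => w.
rewrite (le_trans (ler_normD _ _))// mulrDl lerD//.
  rewrite (le_trans (fM w))// ler_wpM2l// ler_expR ler_wpM2r//.
  by rewrite lerDl.
rewrite (le_trans (gM w))// ler_wpM2l// ler_expR ler_wpM2r//.
by rewrite lerDr.
Qed.

Lemma exp_boundedN f : exp_bounded f -> exp_bounded (fun w => - f w).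
Proof.
move=> [mf [M [a [M0 a0 fM]]]]; split; first exact: measurableT_comp.
by exists M, a; split=> // w; rewrite normrN.
Qed.

Lemma exp_bounded_sum (h : nat -> Om -> R) s :
  (forall i, exp_bounded (h i)) -> exp_bounded (fun w => \sum_(i <- s) h i w).
Proof.
move=> eh; elim: s => [|i s IHs].
  by under eq_fun do rewrite big_nil; exact: exp_bounded_cst.
by under eq_fun do rewrite big_cons; exact: exp_boundedD.
Qed.

Lemma exp_bounded_le f b : measurable_fun [set: Om] f -> 0 <= b ->
  (forall w, `|f w| <= b * N w) -> exp_bounded f.
Proof.
move=> mf b0 fb; split=> //; exists b, 1; split=> // w.
rewrite (le_trans (fb w))// ler_wpM2l// mul1r.
by rewrite (le_trans _ (expR_ge1Dx _))// lerDr.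
Qed.

Lemma exp_bounded_expR f b : measurable_fun [set: Om] f -> 0 <= b ->
  (forall w, `|f w| <= b * N w) -> exp_bounded (fun w => expR (f w)).
Proof.
move=> mf b0 fb; split; first exact: measurableT_comp.
exists 1, b; split=> // w.
by rewrite mul1r ger0_norm ?expR_ge0// ler_expR (le_trans (ler_norm _)).
Qed.

End ExponentialGrowth.

Section GaussianGrowth.
Context {R : realType} {dm : measure_display} {Om : measurableType dm}.
Context (P : probability Om R).

Lemma integrable_has_law (X : {RV P >-> R}) (mu : probability R R) (g : R -> R) :
  has_law P X mu -> mu.-integrable setT (EFin \o g) ->
  P.-integrable setT (EFin \o (g \o X)).
Proof.
move=> Xmu ig; have mg : measurable_fun setT g.
  by apply/measurable_EFinP; exact: measurable_int ig.
apply/integrableP; split.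
  by apply/measurable_EFinP; exact: measurableT_comp.
have [_] := integrableP _ _ _ ig.
rewrite (eq_measure_integral (distribution P X)); last first.
  by move=> B mB _; exact/esym/Xmu.
rewrite ge0_integral_distribution//.
by apply: measurableT_comp => //; exact/measurable_EFinP.
Qed.

Variables (n : nat) (Z : 'I_n -> {RV P >-> R}).
Hypothesis ZN : forall i, std_normal P (Z i).

Definition norm1 (w : Om) : R := \sum_(i < n) `|Z i w|.

Lemma norm1_ge0 w : 0 <= norm1 w.
Proof. exact: sumr_ge0. Qed.

(** The sum of the [|Z_i|] is at most [n] times the largest one, so its
    exponential is controlled by one-dimensional ones; the [1] covers [n = 0]. *)
Lemma expR_norm1_le a w : 0 <= a ->
  expR (a * norm1 w)
  <= 1 + \sum_(i < n) (expR (a * n%:R * Z i w) + expR (- (a * n%:R) * Z i w)).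
Proof.
move=> a0.
have S0 : 0 <= \sum_(i < n)
    (expR (a * n%:R * Z i w) + expR (- (a * n%:R) * Z i w)).
  by apply: sumr_ge0 => i _; rewrite addr_ge0 ?expR_ge0.
case: (posnP n) => [n0|n0].
  rewrite /norm1 big1 ?mulr0 ?expR0 ?lerDl// => i _.
  by have := ltn_ord i; rewrite {2}n0.
have [j _ jmax] := arg_maxP (fun i => `|Z i w|) (isT : xpredT (Ordinal n0)).
have Nj : norm1 w <= n%:R * `|Z j w|.
  rewrite /norm1 mulr_natl -[n in X in _ <= X]card_ord -sumr_const.
  by apply: ler_sum => i _; exact: jmax.
have : expR (a * norm1 w)
    <= expR (a * n%:R * Z j w) + expR (- (a * n%:R) * Z j w).
  apply: (@le_trans _ _ (expR (a * n%:R * `|Z j w|))).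
    by rewrite ler_expR -mulrA ler_wpM2l.
  have [z0|z0] := ger0P (Z j w).
    by rewrite lerDl expR_ge0.
  by rewrite mulrN -mulNr lerDr expR_ge0.
move=> /le_trans; apply.
rewrite (bigD1 j)//= addrCA lerDl addr_ge0//.
by apply: sumr_ge0 => i _; rewrite addr_ge0 ?expR_ge0.
Qed.

Lemma integrable_exp_bounded f : exp_bounded norm1 f ->
  P.-integrable setT (EFin \o f).
Proof.
move=> [mf [M [a [M0 a0 fM]]]].
pose S w := 1 + \sum_(i < n)
  (expR (a * n%:R * Z i w) + expR (- (a * n%:R) * Z i w)).
have iexp b i : P.-integrable setT (fun w => (expR (b * Z i w))%:E).
  by have := integrable_has_law (Z i) _
    (fun x => expR (b * x)) (std_normal_gauss (ZN i)) (gauss_exp_integrable b).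
have iS : P.-integrable setT (fun w => (S w)%:E).
  have -> : (fun w => (S w)%:E) = (fun w => (1%:E + \sum_(i < n)
     ((expR (a * n%:R * Z i w))%:E + (expR (- (a * n%:R) * Z i w))%:E))%E).
    apply/funext => w; rewrite /S EFinD -sumEFin; congr (_ + _)%E.
  apply: integrableD => //.
    exact: finite_measure_integrable_cst.
  apply: integrable_sum => // i _; apply: integrableD => //.
apply: (le_integrable measurableT _ _ (integrableZl measurableT M iS)).
  exact/measurable_EFinP.
move=> w _; rewrite -EFinM/= lee_fin.
rewrite (le_trans (fM w))// (le_trans _ (ler_norm _))// ler_wpM2l//.
exact: expR_norm1_le.
Qed.

End GaussianGrowth.

(** * Factorization of the path *)

Section PathFactorization.
Context {R : realType} (S0 r sigma T K : R) (d : nat) (A : 'M[R]_(d.-1)).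
Context (Z : 'cV[R]_(d.-1)) (x : R) (p : R -> R).
Hypotheses (S0_gt0 : 0 < S0) (K_gt0 : 0 < K) (sigma_gt0 : 0 < sigma).
Hypotheses (T_gt0 : 0 < T) (d_gt0 : (0 < d)%N).
Hypothesis path_tgrid : forall j, (1 <= j < d.+1)%N ->
  p (tgrid T d j) = Num.sqrt (tgrid T d 1) * x + AZ A Z j.-1.

Local Notation t1 := (tgrid T d 1).
Local Notation sqt1 := (Num.sqrt (tgrid T d 1)).
Local Notation omega := (drift r sigma).
Local Notation E := (expR (omega * t1 + sigma * sqt1 * x)).
Local Notation tS := (tS S0 r sigma T A Z).
Local Notation tSA := (tSA S0 r sigma T A Z).

Lemma tgrid1_gt0 : 0 < t1.
Proof. by rewrite /tgrid mul1r divr_gt0 ?ltr0n. Qed.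

Lemma tS_gt0 j : 0 < tS j.
Proof. by rewrite mulr_gt0 ?expR_gt0. Qed.

Lemma tS1 : tS 1 = S0.
Proof. by rewrite /Defs.tS /AZ/= mul0mx mxE subrr !mulr0 addr0 expR0 mulr1. Qed.

(** All summands are positive and the first one is [S0]. *)
Lemma tSA_ge : S0 / d%:R <= tSA.
Proof.
rewrite /Defs.tSA mulrC ler_wpM2l ?invr_ge0 ?ler0n//.
rewrite big_ltn// tS1 lerDl sumr_ge0// => j _.
exact/ltW/tS_gt0.
Qed.

Lemma tSA_gt0 : 0 < tSA.
Proof. by rewrite (lt_le_trans _ tSA_ge)// divr_gt0 ?ltr0n. Qed.

Lemma priceE j : (1 <= j < d.+1)%N -> price S0 r sigma p (tgrid T d j) = E * tS j.
Proof.
move=> jd; rewrite /price path_tgrid// /Defs.tS (mulrCA E) -expRD.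
by congr (_ * expR _); ring.
Qed.

Lemma price_avgE : price_avg S0 r sigma T d p = E * tSA.
Proof.
rewrite /price_avg /Defs.tSA mulrCA; congr (_ * _); rewrite mulr_sumr.
by rewrite !big_nat; apply: eq_bigr => j jd; rewrite priceE.
Qed.

Lemma sum_tS : \sum_(1 <= j < d.+1) tS j = d%:R * tSA.
Proof. by rewrite /Defs.tSA mulrA divff ?mul1r// pnatr_eq0 -lt0n. Qed.

Lemma y_statE : y_stat S0 r sigma T d p
  = E * (T / d%:R * sumB S0 r sigma T A Z + T * sqt1 * tSA * x).
Proof.
have d0 : (d%:R : R) != 0 by rewrite pnatr_eq0 -lt0n.
transitivity (T / d%:R * (E * (sumB S0 r sigma T A Z + sqt1 * x * (d%:R * tSA)))).
  congr (_ * _); rewrite -sum_tS /sumB mulr_sumr -big_split/= mulr_sumr.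
  rewrite !big_nat; apply: eq_bigr => j jd.
  by rewrite priceE// path_tgrid//; ring.
by field.
Qed.

Lemma z_statE : z_stat S0 r sigma T d p
  = T ^+ 2 / d%:R ^+ 2 * E ^+ 2
    * (sumC S0 r sigma T A Z + sqt1 * sumD S0 r sigma T A Z * x).
Proof.
rewrite -[RHS]mulrA; congr (_ * _).
rewrite /sumC /sumD mulr_sumr mulr_suml -big_split/= mulr_sumr.
rewrite !big_nat; apply: eq_bigr => i /andP[i1 id].
rewrite mulr_sumr mulr_suml -big_split/= mulr_sumr.
rewrite !big_nat; apply: eq_bigr => j /andP[ij jd].
have jd' : (1 <= j < d.+1)%N by rewrite (leq_trans i1 ij).
rewrite !priceE// ?i1// path_tgrid//; ring.
Qed.

(** [psi] is the value of [X1] at which the average [E * tSA] equals [K]. *)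
Lemma psi_lt : (psi S0 r sigma T A K Z < x) = (K < E * tSA).
Proof.
have s0 : 0 < sigma * sqt1 by rewrite mulr_gt0// sqrtr_gt0 tgrid1_gt0.
rewrite /psi ltr_pdivrMr// -[RHS]ltr_ln ?posrE//; last first.
  by apply: mulr_gt0; [exact: expR_gt0|exact: tSA_gt0].
rewrite lnM ?posrE ?expR_gt0 ?tSA_gt0// expRK.
by apply/idP/idP => h; lra.
Qed.

Lemma call_payoffE y : call_payoff K y = (y - K) * (K < y)%R%:R.
Proof.
rewrite /call_payoff; case: ltP => [Ky|yK].
  by rewrite mulr1 max_l// subr_ge0 ltW.
by rewrite mulr0 max_r// subr_le0.
Qed.

Lemma greek_estimateE (weight : R -> R -> R -> R -> R) :
  greek_estimate S0 r sigma T d weight (call_payoff K) p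
  = expR (- (r * T)) * (E * tSA - K)
    * weight (E * tSA) (E * tS d)
        (E * (T / d%:R * sumB S0 r sigma T A Z + T * sqt1 * tSA * x))
        (T ^+ 2 / d%:R ^+ 2 * E ^+ 2
         * (sumC S0 r sigma T A Z + sqt1 * sumD S0 r sigma T A Z * x))
    * (psi S0 r sigma T A K Z < x)%R%:R.
Proof.
rewrite /greek_estimate price_avgE priceE ?d_gt0 ?ltnSn// y_statE z_statE.
by rewrite psi_lt call_payoffE mulrA -!mulrA; congr (_ * (_ * _)); rewrite mulrC.
Qed.

End PathFactorization.

(** * Growth of the coefficients and conditional expectation of one term *)

Section CoefficientGrowth.
Context {R : realType} {dm : measure_display} {Om : measurableType dm}.
Context (Q : probability Om R) (S0 r sigma T K : R) (d : nat).
Context (X : {RV Q >-> R}) (Z : 'I_(d.-1) -> {RV Q >-> R}) (A : 'M[R]_(d.-1)).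
Hypotheses (S0_gt0 : 0 < S0) (T_gt0 : 0 < T) (d_gt0 : (0 < d)%N).
Hypothesis Xnormal : std_normal Q X.
Hypothesis Znormal : forall i, std_normal Q (Z i).

(** The generating family whose sigma-algebra is [g_sigma_preimage]. Naming it
    makes the sigma-algebra of [Z] a measurable structure, so that measurability
    with respect to [Z] is ordinary [measurable_fun] on [OmZ]. *)
Let genZ : set (set Om) :=
  \big[setU/set0]_(i < d.-1) preimage_set_system setT (Z i) measurable.
Local Notation sigmaZ := (g_sigma_preimage (fun i w => Z i w)).
Local Notation OmZ := (g_sigma_algebraType genZ).

Hypothesis XZ : independent_of Q X sigmaZ.

Local Notation Zv := (fun w : OmZ => \col_i Z i w).
Local Notation growth := (exp_bounded (norm1 Q d.-1 Z : OmZ -> R)).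

Lemma sub_sigmaZ : sigmaZ `<=` measurable.
Proof.
apply: smallest_sub; first exact: sigma_algebra_measurable.
rewrite -bigcup_seq; apply: bigcup_sub => i _ _ [B mB <-].
exact: measurable_funPT.
Qed.

Lemma measurable_Z i : measurable_fun [set: OmZ] (Z i : OmZ -> R).
Proof.
move=> _ B mB; apply: sub_sigma_algebra; rewrite /genZ -bigcup_seq.
by exists i => /=; [rewrite mem_index_enum|exists B].
Qed.

Lemma AZE k w : AZ A (Zv w) k = \sum_i rowA A k 0 i * Z i w.
Proof. by rewrite /AZ mxE; apply: eq_bigr => i _; rewrite mxE. Qed.

Lemma measurable_AZ k : measurable_fun [set: OmZ] (fun w => AZ A (Zv w) k).
Proof.
under eq_fun do rewrite AZE; apply: measurable_sum => i.
by apply: measurable_funM => //; exact: measurable_Z.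
Qed.

Lemma AZ_le k : exists2 b, 0 <= b &
  forall w, `|AZ A (Zv w) k| <= b * norm1 Q d.-1 Z w.
Proof.
exists (\sum_i `|rowA A k 0 i|) => [|w]; first exact: sumr_ge0.
rewrite AZE (le_trans (ler_norm_sum _ _ _))// /norm1 mulr_sumr.
apply: ler_sum => i _; rewrite normrM ler_wpM2r//.
by rewrite (bigD1 i)//= lerDl sumr_ge0.
Qed.

Lemma growth_AZ k : growth (fun w => AZ A (Zv w) k).
Proof.
have [b b0 bA] := AZ_le k.
by apply: exp_bounded_le bA => //; exact: measurable_AZ.
Qed.

Lemma growth_tS j : growth (fun w => tS S0 r sigma T A (Zv w) j).
Proof.
have [b b0 bA] := AZ_le j.-1.
rewrite /tS; apply: exp_boundedM; first exact: exp_bounded_cst.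
under eq_fun do rewrite expRD; apply: exp_boundedM; first exact: exp_bounded_cst.
apply: (@exp_bounded_expR _ _ _ _ _ (`|sigma| * b)).
- by apply: measurable_funM => //; exact: measurable_AZ.
- by rewrite mulr_ge0.
- by move=> w; rewrite normrM -mulrA ler_wpM2l.
Qed.
Let growthD f g : growth f -> growth g -> growth (fun w => f w + g w).
Proof. exact: (@exp_boundedD R _ OmZ (norm1 Q d.-1 Z) (norm1_ge0 Q d.-1 Z)). Qed.

Let growth_sum (h : nat -> OmZ -> R) s : (forall i, growth (h i)) ->
  growth (fun w => \sum_(i <- s) h i w).
Proof. exact: (@exp_bounded_sum R _ OmZ (norm1 Q d.-1 Z) (norm1_ge0 Q d.-1 Z)). Qed.

Lemma growth_tSA : growth (fun w => tSA S0 r sigma T A (Zv w)).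
Proof.
apply: exp_boundedM; first exact: exp_bounded_cst.
by apply: growth_sum => j; exact: growth_tS.
Qed.

Lemma measurable_ln_tSA :
  measurable_fun [set: OmZ] (fun w => ln (tSA S0 r sigma T A (Zv w))).
Proof. by apply: measurableT_comp; [exact: measurable_ln|case: growth_tSA]. Qed.

(** Bounded by [d / S0]; measurable as the exponential of [- ln tSA]. *)
Lemma growth_tSAV : growth (fun w => (tSA S0 r sigma T A (Zv w))^-1).
Proof.
apply: (@exp_bounded_bounded _ _ _ _ _ (d%:R / S0)).
  have -> : (fun w => (tSA S0 r sigma T A (Zv w))^-1)
      = (fun w => expR (- ln (tSA S0 r sigma T A (Zv w)))).
    by apply/funext => w; rewrite expRN lnK// posrE tSA_gt0.
  apply: measurableT_comp => //; apply: measurableT_comp => //.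
  exact: measurable_ln_tSA.
move=> w; rewrite ger0_norm; last by rewrite invr_ge0 ltW// tSA_gt0.
rewrite -(invf_div S0) lef_pV2 ?posrE ?tSA_gt0 ?divr_gt0 ?ltr0n//.
exact: tSA_ge.
Qed.

Let growth_AZshift j :
  growth (fun w => AZ A (Zv w) j.-1 - sigma * tgrid T d j).
Proof. by apply: growthD; [exact: growth_AZ|exact: exp_bounded_cst]. Qed.

Lemma growth_sumB : growth (fun w => sumB S0 r sigma T A (Zv w)).
Proof.
by apply: growth_sum => j; apply: exp_boundedM; [exact: growth_tS|].
Qed.

Lemma growth_sumC : growth (fun w => sumC S0 r sigma T A (Zv w)).
Proof.
apply: growth_sum => i; apply: growth_sum => j; apply: exp_boundedM => //.
by apply: exp_boundedM; exact: growth_tS.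
Qed.

Lemma growth_sumD : growth (fun w => sumD S0 r sigma T A (Zv w)).
Proof.
by apply: growth_sum => i; apply: growth_sum => j; apply: exp_boundedM;
  exact: growth_tS.
Qed.

Lemma measurable_psi :
  measurable_fun [set: OmZ] (fun w => psi S0 r sigma T A K (Zv w)).
Proof.
rewrite /psi; apply: measurable_funM => //; apply: measurable_funB => //.
by apply: measurable_funB => //; exact: measurable_ln_tSA.
Qed.

Lemma growth_integrable (c : OmZ -> R) :
  growth c -> Q.-integrable [set: Om] (EFin \o c).
Proof.
move=> [mc cle]; apply: (integrable_exp_bounded Q _ Z Znormal); split=> //.
by apply: measurable_coarsen mc; exact: sub_sigmaZ.
Qed.

Lemma is_cond_exp_exp_tail a (c : OmZ -> R) : growth c ->
  is_cond_exp Q sigmaZ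
    (fun w => c w * expR (a * X w) * (psi S0 r sigma T A K (Zv w) < X w)%R%:R)
    (fun w => c w
      * (expR (a ^+ 2 / 2) * Phi (a - psi S0 r sigma T A K (Zv w)))).
Proof.
move=> gc; apply: (is_cond_exp_tail Q genZ sub_sigmaZ X gauss
    (std_normal_gauss Xnormal) XZ c _ (fun x => expR (a * x))
    (fun u => expR (a ^+ 2 / 2) * Phi (a - u))).
- by case: gc.
- exact: growth_integrable.
- exact: measurable_psi.
- exact: gauss_exp_integrable.
- by move=> u; exact: gauss_exp_tail.
Qed.

Lemma is_cond_exp_Xexp_tail a (c : OmZ -> R) : growth c ->
  is_cond_exp Q sigmaZ
    (fun w => c w * (X w * expR (a * X w))
              * (psi S0 r sigma T A K (Zv w) < X w)%R%:R)
    (fun w => c w * (expR (a ^+ 2 / 2)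
      * (a * Phi (a - psi S0 r sigma T A K (Zv w))
         + phi0 (psi S0 r sigma T A K (Zv w) - a)))).
Proof.
move=> gc; apply: (is_cond_exp_tail Q genZ sub_sigmaZ X gauss
    (std_normal_gauss Xnormal) XZ c _ (fun x => x * expR (a * x))
    (fun u => expR (a ^+ 2 / 2) * (a * Phi (a - u) + phi0 (u - a)))).
- by case: gc.
- exact: growth_integrable.
- exact: measurable_psi.
- exact: gauss_Xexp_integrable.
- by move=> u; exact: gauss_Xexp_tail.
Qed.

End CoefficientGrowth.

(** * The conditional Greeks *)

Section Greeks.
Context {R : realType} {dm : measure_display} {Om : measurableType dm}.
Context (Q : probability Om R) (S0 r sigma T K : R) (d : nat).
Context (X : {RV Q >-> R}) (Z : 'I_(d.-1) -> {RV Q >-> R}) (A : 'M[R]_(d.-1)).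
Context (W : Om -> R -> R).
Hypotheses (S0_gt0 : 0 < S0) (K_gt0 : 0 < K) (sigma_gt0 : 0 < sigma).
Hypotheses (T_gt0 : 0 < T) (d_gt0 : (0 < d)%N).
Hypothesis Xnormal : std_normal Q X.
Hypothesis Znormal : forall i, std_normal Q (Z i).
Local Notation sigmaZ := (g_sigma_preimage (fun i w => Z i w)).
Hypothesis XZ : independent_of Q X sigmaZ.
Hypothesis path_tgrid : forall w j, (1 <= j < d.+1)%N ->
  W w (tgrid T d j)
  = Num.sqrt (tgrid T d 1) * X w + AZ A (\col_i Z i w) j.-1.

Local Notation t1 := (tgrid T d 1).
Local Notation sqt1 := (Num.sqrt (tgrid T d 1)).
Local Notation omega := (drift r sigma).
Local Notation disc := (expR (- (r * T))).
Local Notation s := (sigma * sqt1).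
Local Notation p := (expR (omega * t1)).
Local Notation h := (expR (sigma ^+ 2 * t1 / 2)).
Local Notation Zv w := (\col_i Z i w).
Local Notation tSd w := (tS S0 r sigma T A (Zv w) d).
Local Notation tSAw w := (tSA S0 r sigma T A (Zv w)).

(* The exponentials below are all monomials in [disc], [p] and [h]; expressing
   them so makes the final identities rational, within reach of [field]. *)
Let sqr_s : s ^+ 2 = sigma ^+ 2 * t1.
Proof. by rewrite exprMn sqr_sqrtr// ltW// tgrid1_gt0. Qed.

Let exp_s : expR (s ^+ 2 / 2) = h. Proof. by rewrite sqr_s. Qed.

Let exp_Ns : expR ((- s) ^+ 2 / 2) = h. Proof. by rewrite sqrrN sqr_s. Qed.

Let exp_N2s : expR ((- (2 * sigma * sqt1)) ^+ 2 / 2) = h ^+ 4.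
Proof.
by rewrite -expRM_natl sqrrN -(mulrA 2) exprMn sqr_s; congr expR; field.
Qed.

Let exp_0 : expR ((0 : R) ^+ 2 / 2) = 1.
Proof. by rewrite expr0n mul0r expR0. Qed.

Let exp_rt1 : expR (r * t1) = p * h.
Proof. by rewrite -expRD; congr expR; rewrite /drift; field. Qed.

Let exp_disc_t1 : expR (- (r * T) - r * t1 + sigma ^+ 2 * t1) = disc * (h / p).
Proof. by rewrite -expRN -!expRD; congr expR; rewrite /drift; field. Qed.

Let exp_Nrt1 : expR (- (r * t1) + sigma ^+ 2 * t1) = h / p.
Proof. by rewrite -expRN -!expRD; congr expR; rewrite /drift; field. Qed.

Let exp_N2rt1 : expR (- (2 * r * t1) + 3 * sigma ^+ 2 * t1) = h ^+ 4 / p ^+ 2.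
Proof.
by rewrite -!expRM_natl -expRN -!expRD; congr expR; rewrite /drift; field.
Qed.

Let exp_half_sub : expR (sigma ^+ 2 * t1 / 2 - omega * t1) = h / p.
Proof. by rewrite expRB. Qed.

Let exp_half_add : expR (sigma ^+ 2 * t1 / 2 + omega * t1) = p * h.
Proof. by rewrite expRD mulrC. Qed.

Let phi0_shift u : (Num.sqrt (2 * pi))^-1
    * expR (sigma ^+ 2 * t1 / 2 + omega * t1 - (u - s) ^+ 2 / 2)
  = p * h * phi0 (u - s).
Proof. by rewrite /phi0 expRD exp_half_add mulrCA mulNr. Qed.

Let is_cond_exp_eq (X1 X2 Y1 Y2 : Om -> R) : X1 =1 X2 -> Y1 =1 Y2 ->
  is_cond_exp Q sigmaZ X1 Y1 -> is_cond_exp Q sigmaZ X2 Y2.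
Proof. by move=> /funext -> /funext ->. Qed.

Let cond_expD (X1 X2 Y1 Y2 : Om -> R) :
  is_cond_exp Q sigmaZ X1 Y1 -> is_cond_exp Q sigmaZ X2 Y2 ->
  is_cond_exp Q sigmaZ (fun w => X1 w + X2 w) (fun w => Y1 w + Y2 w).
Proof. by move=> c1 c2; apply: is_cond_expD => //; exact: sub_sigmaZ. Qed.

Let genZ : set (set Om) :=
  \big[setU/set0]_(i < d.-1) preimage_set_system setT (Z i) measurable.
Local Notation OmZ := (g_sigma_algebraType genZ).
Local Notation growth := (exp_bounded (norm1 Q d.-1 Z : OmZ -> R)).

Let exp_tail a (c : OmZ -> R) : growth c -> is_cond_exp Q sigmaZ
    (fun w => c w * expR (a * X w) * (psi S0 r sigma T A K (Zv w) < X w)%R%:R)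
    (fun w => c w
      * (expR (a ^+ 2 / 2) * Phi (a - psi S0 r sigma T A K (Zv w)))).
Proof. exact: is_cond_exp_exp_tail. Qed.

Let Xexp_tail a (c : OmZ -> R) : growth c -> is_cond_exp Q sigmaZ
    (fun w => c w * (X w * expR (a * X w))
              * (psi S0 r sigma T A K (Zv w) < X w)%R%:R)
    (fun w => c w * (expR (a ^+ 2 / 2)
      * (a * Phi (a - psi S0 r sigma T A K (Zv w))
         + phi0 (psi S0 r sigma T A K (Zv w) - a)))).
Proof. exact: is_cond_exp_Xexp_tail. Qed.

Let growthD (f g : OmZ -> R) : growth f -> growth g ->
  growth (fun w => f w + g w).
Proof. exact: (@exp_boundedD R _ OmZ (norm1 Q d.-1 Z) (norm1_ge0 Q d.-1 Z)). Qed.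

Local Ltac growth := repeat first
  [ exact: exp_bounded_cst | exact: growth_tS | exact: growth_tSA
  | exact: growth_tSAV | exact: growth_sumB | exact: growth_sumC
  | exact: growth_sumD | apply: exp_boundedN | apply: exp_boundedM
  | apply: growthD ].

Let p_neq0 : p != 0. Proof. by rewrite gt_eqF// expR_gt0. Qed.
Let tSA_neq0 w : tSAw w != 0. Proof. by rewrite gt_eqF// tSA_gt0. Qed.
Let S0_neq0 : S0 != 0. Proof. by rewrite gt_eqF. Qed.
Let sigma_neq0 : sigma != 0. Proof. by rewrite gt_eqF. Qed.
Let T_neq0 : T != 0. Proof. by rewrite gt_eqF. Qed.
Let d_neq0 : d%:R != 0 :> R. Proof. by rewrite pnatr_eq0 -lt0n. Qed.
Let expX_neq0 w : expR (s * X w) != 0. Proof. by rewrite gt_eqF// expR_gt0. Qed.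

(** [(E * tSA - K) * weight_delta] has three terms, in [E], [1] and [1 / E]. *)
Lemma cond_exp_delta :
  is_cond_exp Q sigmaZ
    (fun w => greek_estimate S0 r sigma T d
       (weight_delta S0 r sigma T) (call_payoff K) (W w))
    (fun w => G_delta2 S0 r sigma T A K (Zv w)).
Proof.
pose k := disc * (2 / (S0 * sigma ^+ 2)).
pose cup w := k * p * (tSd w * T^-1 - omega * tSAw w).
pose cmid w := k * (- (S0 / T) + K * (omega - T^-1 * (tSd w * (tSAw w)^-1))).
pose cdn w := k * (K * S0 / (T * p)) * (tSAw w)^-1.
have Hup := exp_tail s cup.
have Hmid := exp_tail 0 cmid.
have Hdn := exp_tail (- s) cdn.
apply: (is_cond_exp_eq _ _ _ _ _ _
  (cond_expD _ _ _ _ (cond_expD _ _ _ _ (Hup _) (Hmid _)) (Hdn _))).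
- move=> w.
  rewrite (greek_estimateE S0 r sigma T K d A (Zv w) (X w))//; last first.
    exact: path_tgrid.
  rewrite -!mulrDl; congr (_ * _).
  rewrite (expRD (omega * t1)) (mulNr s) (expRN (s * X w)) mul0r expR0.
  rewrite /weight_delta /cup /cmid /cdn /k.
  move: (tSA_neq0 w) (expX_neq0 w) p_neq0; move: (tSd w) (tSAw w) (expR (s * X w)) p disc.
  by move=> D B e q c B0 e0 q0; field; rewrite ?S0_neq0 ?sigma_neq0 ?T_neq0 ?B0 ?e0 ?q0.
- move=> w; rewrite exp_s exp_Ns exp_0 sub0r.
  rewrite /G_delta2 /G_delta1 exp_rt1 exp_disc_t1 -/(Phi1 _ _ _ _ _ _ _).
  rewrite -/(Phi2 S0 r sigma T A K (Zv w)) -/(tPhi2 S0 r sigma T A K (Zv w)).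
  rewrite /cup /cmid /cdn /k.
  move: (tSA_neq0 w) p_neq0.
  move: (Phi1 _ _ _ _ _ _ _) (Phi2 _ _ _ _ _ _ _) (tPhi2 _ _ _ _ _ _ _).
  move: (tSd w) (tSAw w) h p disc.
  by move=> D B h' q c F1 F2 F3 B0 q0; field; rewrite ?S0_neq0 ?sigma_neq0 ?T_neq0 ?B0 ?q0.
all: rewrite /cup /cmid /cdn; growth.
Qed.
(** Here the powers of [E] run from [1] down to [-2]; the last one gives [Phi3]. *)
Lemma cond_exp_gamma :
  is_cond_exp Q sigmaZ
    (fun w => greek_estimate S0 r sigma T d
       (weight_gamma S0 r sigma T) (call_payoff K) (W w))
    (fun w => G_gamma2 S0 r sigma T A K (Zv w)).
Proof.
(* [weight_gamma] is [4 / (sigma^4 S0^2 T^2)] times [q2 + q1 / E + q0 / E^2]; the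
   coefficients [c1 .. cN2] of [exp (s X), .., exp (- 2 s X)] come from
   multiplying this by [E * tSA - K]. *)
pose k := disc * (4 / (sigma ^+ 4 * S0 ^+ 2 * T ^+ 2)).
pose q2 w := tSd w * tSd w * ((tSAw w)^-1 * (tSAw w)^-1) + omega * r * T ^+ 2
             - 2 * r * T * (tSd w * (tSAw w)^-1).
pose q1 w := 2 * omega * T * S0 * (tSAw w)^-1
             - 2 * S0 * (tSd w * ((tSAw w)^-1 * (tSAw w)^-1)).
pose q0 w := S0 ^+ 2 * ((tSAw w)^-1 * (tSAw w)^-1).
pose c1 w := k * p * (tSAw w * q2 w).
pose c0 w := k * (tSAw w * q1 w - K * q2 w).
pose cN1 w := k * p^-1 * (tSAw w * q0 w - K * q1 w).
pose cN2 w := k * (p ^- 2 * - K) * q0 w.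
have H1 := exp_tail s c1.
have H0 := exp_tail 0 c0.
have HN1 := exp_tail (- s) cN1.
have HN2 := exp_tail (- (2 * sigma * sqt1)) cN2.
apply: (is_cond_exp_eq _ _ _ _ _ _ (cond_expD _ _ _ _ (cond_expD _ _ _ _
  (cond_expD _ _ _ _ (H1 _) (H0 _)) (HN1 _)) (HN2 _))).
- move=> w.
  rewrite (greek_estimateE S0 r sigma T K d A (Zv w) (X w))//; last first.
    exact: path_tgrid.
  rewrite -!mulrDl; congr (_ * _).
  have -> : expR (- (2 * sigma * sqt1) * X w) = expR (s * X w) ^- 2.
    by rewrite -expRM_natl -expRN; congr expR; ring.
  rewrite (expRD (omega * t1)) (mulNr s) (expRN (s * X w)) mul0r expR0.
  rewrite /weight_gamma /c1 /c0 /cN1 /cN2 /q2 /q1 /q0 /k.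
  move: (tSA_neq0 w) (expX_neq0 w) p_neq0.
  move: (tSd w) (tSAw w) (expR (s * X w)) p disc.
  by move=> D B e q c B0 e0 q_0; field;
    rewrite ?S0_neq0 ?sigma_neq0 ?T_neq0 ?B0 ?e0 ?q_0.
- move=> w; rewrite exp_s exp_Ns exp_0 exp_N2s sub0r.
  rewrite /G_gamma2 /G_gamma1 exp_rt1 exp_Nrt1 exp_N2rt1 -/(Phi1 _ _ _ _ _ _ _).
  rewrite -/(Phi2 S0 r sigma T A K (Zv w)) -/(tPhi2 S0 r sigma T A K (Zv w)).
  rewrite -/(Phi3 S0 r sigma T A K (Zv w)).
  rewrite /c1 /c0 /cN1 /cN2 /q2 /q1 /q0 /k.
  move: (tSA_neq0 w) p_neq0.
  move: (Phi1 _ _ _ _ _ _ _) (Phi2 _ _ _ _ _ _ _) (Phi3 _ _ _ _ _ _ _).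
  move: (tPhi2 _ _ _ _ _ _ _) (tSd w) (tSAw w) h p disc.
  by move=> F4 D B h' q c F1 F2 F3 B0 q_0; field;
    rewrite ?S0_neq0 ?sigma_neq0 ?T_neq0 ?B0 ?q_0.
all: rewrite /c1 /c0 /cN1 /cN2 /q2 /q1 /q0; growth.
Qed.

(** The statistics [y_stat] and [z_stat] are affine in [X], so besides the powers
    [1], [0], [-1] of [E] the same powers multiplied by [X] occur; these are the
    source of the Gaussian densities in the formula. *)
Lemma cond_exp_vega :
  is_cond_exp Q sigmaZ
    (fun w => greek_estimate S0 r sigma T d
       (weight_vega S0 r sigma T) (call_payoff K) (W w))
    (fun w => G_vega2 S0 r sigma T A K (Zv w)).
Proof.
(* [y_stat / (E tSA) = y0 + y1 X], and [weight_vega] is [2 / (sigma^2 T^2)] times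
   [v0 + v1 X - S0 iA (y0 + y1 X) / E]. Multiplying by [E tSA - K] gives the
   coefficients [c1], [c0], [cN] of [exp (s X)], [1], [exp (- s X)] and [x1],
   [x0], [xN] of the same functions times [X]. *)
pose k := disc * (2 / (sigma ^+ 2 * T ^+ 2)).
pose iA w := (tSAw w)^-1.
pose y0 w := T / d%:R * (sumB S0 r sigma T A (Zv w) * iA w).
pose y1 : R := T * sqt1.
pose a w := tSd w * iA w - (r - sigma ^+ 2) * T.
pose v0 w := a w * y0 w
  - sigma ^+ 2 * (T ^+ 2 / d%:R ^+ 2)
    * (sumC S0 r sigma T A (Zv w) * (iA w * iA w))
  - sigma * T ^+ 2 / 2.
pose v1 w := y1 * a w
  - sigma ^+ 2 * (T ^+ 2 / d%:R ^+ 2) * sqt1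
    * (sumD S0 r sigma T A (Zv w) * (iA w * iA w)).
pose c1 w := k * p * (tSAw w * v0 w).
pose x1 w := k * p * (tSAw w * v1 w).
pose c0 w := - k * (S0 * y0 w + K * v0 w).
pose x0 w := - k * (S0 * y1 + K * v1 w).
pose cN w := k * (K * S0 / p) * (iA w * y0 w).
pose xN w := k * (K * S0 / p) * (iA w * y1).
have C1 := exp_tail s c1; have X1 := Xexp_tail s x1.
have C0 := exp_tail 0 c0; have X0 := Xexp_tail 0 x0.
have CN := exp_tail (- s) cN; have XN := Xexp_tail (- s) xN.
apply: (is_cond_exp_eq _ _ _ _ _ _ (cond_expD _ _ _ _ (cond_expD _ _ _ _
  (cond_expD _ _ _ _ (C1 _) (X1 _)) (cond_expD _ _ _ _ (C0 _) (X0 _)))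
  (cond_expD _ _ _ _ (CN _) (XN _)))).
- move=> w.
  rewrite (greek_estimateE S0 r sigma T K d A (Zv w) (X w))//; last first.
    exact: path_tgrid.
  rewrite -!mulrDl; congr (_ * _).
  rewrite (expRD (omega * t1)) (mulNr s) (expRN (s * X w)) mul0r expR0.
  rewrite /weight_vega /c1 /c0 /cN /x1 /x0 /xN /v0 /v1 /a /y0 /y1 /iA /k.
  move: (tSA_neq0 w) (expX_neq0 w) p_neq0.
  move: (sumB _ _ _ _ _ _) (sumC _ _ _ _ _ _) (sumD _ _ _ _ _ _).
  move: (tSd w) (tSAw w) (expR (s * X w)) p disc.
  by move=> D B e q c b1 b2 b3 B0 e0 q_0; field;
    rewrite ?S0_neq0 ?sigma_neq0 ?T_neq0 ?d_neq0 ?B0 ?e0 ?q_0.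
- move=> w; rewrite exp_s exp_Ns exp_0 sub0r subr0 opprK.
  rewrite /G_vega2 /G_vega1 exp_half_sub phi0_shift exp_half_add exp_rt1 exp_Nrt1.
  rewrite -/(Phi1 _ _ _ _ _ _ _).
  rewrite -/(Phi2 S0 r sigma T A K (Zv w)) -/(tPhi2 S0 r sigma T A K (Zv w)).
  rewrite /c1 /c0 /cN /x1 /x0 /xN /v0 /v1 /a /y0 /y1 /iA /k.
  move: (tSA_neq0 w) p_neq0.
  move: (sumB _ _ _ _ _ _) (sumC _ _ _ _ _ _) (sumD _ _ _ _ _ _).
  move: (Phi1 _ _ _ _ _ _ _) (Phi2 _ _ _ _ _ _ _) (tPhi2 _ _ _ _ _ _ _).
  move: (phi0 (psi _ _ _ _ _ _ _)) (phi0 (psi _ _ _ _ _ _ _ - s)).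
  move: (phi0 (psi _ _ _ _ _ _ _ + s)).
  move: (tSd w) (tSAw w) h p disc.
  by move=> D B h' q c f1 f2 f3 F1 F2 F3 b1 b2 b3 B0 q_0; field;
    rewrite ?S0_neq0 ?sigma_neq0 ?T_neq0 ?d_neq0 ?B0 ?q_0.
all: rewrite /c1 /c0 /cN /x1 /x0 /xN /v0 /v1 /a /y0 /y1 /iA; growth.
Qed.

End Greeks.

Theorem theorem6p4 (R : realType) (dm : measure_display)
    (Om : measurableType dm) (Q : probability Om R)
    (S0 K r sigma T : R) (d : nat)
    (W : R -> {RV Q >-> R})
    (X1 : {RV Q >-> R}) (Z : 'I_(d.-1) -> {RV Q >-> R})
    (A : 'M[R]_(d.-1)) :
  0 < S0 -> 0 < K -> 0 < r -> 0 < sigma -> 0 < T -> (2 <= d)%N ->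
  brownian_motion T W ->
  std_normal Q X1 ->
  (forall i, std_normal Q (Z i)) ->
  mutually_independent Q (fun i w => Z i w) ->
  independent_of Q X1 (g_sigma_preimage (fun i w => Z i w)) ->
  A *m A^T = increment_cov T d ->
  (forall w, W (tgrid T d 1) w = Num.sqrt (tgrid T d 1) * X1 w) ->
  (forall (i : 'I_(d.-1)) w,
     W (tgrid T d i.+2) w - W (tgrid T d 1) w
     = (A *m \col_l Z l w) i 0) ->
  [/\ is_cond_exp Q (g_sigma_preimage (fun i w => Z i w))
        (fun w => greek_estimate S0 r sigma T d
           (weight_delta S0 r sigma T) (call_payoff K) (fun t => W t w))
        (fun w => G_delta2 S0 r sigma T A K (\col_i Z i w)),
      is_cond_exp Q (g_sigma_preimage (fun i w => Z i w))
        (fun w => greek_estimate S0 r sigma T d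
           (weight_gamma S0 r sigma T) (call_payoff K) (fun t => W t w))
        (fun w => G_gamma2 S0 r sigma T A K (\col_i Z i w)) &
      is_cond_exp Q (g_sigma_preimage (fun i w => Z i w))
        (fun w => greek_estimate S0 r sigma T d
           (weight_vega S0 r sigma T) (call_payoff K) (fun t => W t w))
        (fun w => G_vega2 S0 r sigma T A K (\col_i Z i w))].
Proof.
move=> S0_gt0 K_gt0 _ sigma_gt0 T_gt0 d_ge2 _ X1n Zn _ XZ _ W1 Winc.
have d_gt0 : (0 < d)%N by exact: leq_trans d_ge2.
have path w j : (1 <= j < d.+1)%N ->
    W (tgrid T d j) w = Num.sqrt (tgrid T d 1) * X1 w + AZ A (\col_i Z i w) j.-1.
  case: j => [//|[_|j jd]]; first by rewrite W1 /AZ/= mul0mx mxE addr0.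
  have jd1 : (j < d.-1)%N by rewrite -ltnS (ltn_predK d_gt0).
  have := Winc (Ordinal jd1) w; rewrite /= W1 => /eqP.
  rewrite subr_eq addrC => /eqP ->; congr (_ + _).
  by rewrite /AZ/= (insubT (fun i => i < d.-1)%N jd1) -row_mul
    [RHS]mxE.
split.
- exact: (cond_exp_delta Q S0 r sigma T K d X1 Z A (fun w t => W t w)).
- exact: (cond_exp_gamma Q S0 r sigma T K d X1 Z A (fun w t => W t w)).
- exact: (cond_exp_vega Q S0 r sigma T K d X1 Z A (fun w t => W t w)).
Qed.
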